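(* Let $G$ be a metabelian $3$-group with abelianization $G/G'$ of type $(3,3)$, of coclass $r\ge3$ and $e=r+1\ge4$, order $|G|=3^n\ge3^7$, nilpotency class $c=m-1\ge4$ with $5\le m<n-1$, and defect of commutativity $k=0$. Let $\mathfrak{A}=\mathfrak{A}(G)\unlhd\mathbb{Z}[X,Y]$ be the annihilator of $G$. Then $$G'\simeq\mathbb{Z}[X,Y]/\mathfrak{A}\simeq A(3,m-2)\oplus A(3,e-2)$$ (isomorphisms of groups, the middle term being the additive group of the residue class ring), the direct sum of two nearly homocyclic abelian $3$-groups of orders $3^{m-2}$ and $3^{e-2}$. Therefore $G'$ is non-elementary of $3$-rank exactly four.
   Context: Nearly homocyclic $3$-groups: for $\mu\ge2$, $A(3,\mu)$ is the abelian group of type $(3^{\mu/2},3^{\mu/2})$ if $\mu$ is even and $(3^{(\mu+1)/2},3^{(\mu-1)/2})$ if $\mu$ is odd. Conventions: $[a,b]=a^{-1}b^{-1}ab$, $t^g=g^{-1}tg$; $\gamma_j=\gamma_j(G)$ is the lower central series, $G'=\gamma_2$; $m$ is the index of nilpotency ($\gamma_m=1\ne\gamma_{m-1}$); coclass $r=n-c$. The CF-invariant $e$ is defined by $e+1=\min\{j\ge3:(\gamma_j:\gamma_{j+1})\le3\}$ and equals $r+1$. Put $\chi_j(G)=\{g\in G:[u,g]\in\gamma_{j+2}\ \forall u\in\gamma_j\}$ and $s=\min\{2\le j\le m-1:\chi_j(G)>G'\}$. The defect $k\in\{0,1\}$ is defined by $[\chi_s(G),\gamma_e]=\gamma_{m-k}$.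 Normalized generators $x,y$ of $G$: $\gamma_3=\langle y^3,x^3,\gamma_4\rangle$, $x\in G\setminus\chi_s(G)$ if $s<m-1$, and $y\in\chi_s(G)\setminus G'$. Put $s_2=[y,x]$. Conjugation makes $G'$ a $\mathbb{Z}[G]$-module, $t^{ag+bh}=(t^g)^a(t^h)^b$ (so $t^{x-1}=[t,x]$, $t^{y-1}=[t,y]$; the actions of $x,y$ on $G'$ commute). The annihilator (with respect to normalized generators $x,y$) is the ideal $\mathfrak{A}(G)=\{f\in\mathbb{Z}[X,Y]:s_2^{f(x-1,y-1)}=1\}$. *)

(* Defs.v *)
From HB Require Import structures.
From mathcomp Require Import all_boot all_order all_algebra.
From mathcomp Require Import all_fingroup all_solvable.
From mathcomp Require Import ring_quotient.
From mathcomp.multinomials Require Import ssrcomplements mpoly.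

Set Implicit Arguments.
Unset Strict Implicit.
Unset Printing Implicit Defensive.

Import GRing.Theory FinRing.Theory FiniteModule.

Local Open Scope group_scope.

Definition least (P : nat -> Prop) (j : nat) : Prop :=
  P j /\ forall i, P i -> (j <= i)%N.

Section Invariants.

Variables (gT : finGroupType) (G : {group gT}).

Definition nilpotency_index : nat := (nil_class G).+1.

(* The CF-invariant e, determined by e + 1 = min {j >= 3 : |L_j : L_(j+1)| <= 3}. *)
Definition is_CF_invariant (e : nat) : Prop :=
  least (fun j => (3 <= j)%N /\ (#|'L_j(G) : 'L_j.+1(G)| <= 3)%N) e.+1.

Definition two_step_centralizer (j : nat) : {set gT} :=
  [set g in G | [forall u in 'L_j(G), [~ u, g] \in 'L_j.+2(G)]].

Definition is_first_two_step (s : nat) : Prop :=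
  least (fun j => (2 <= j <= nilpotency_index.-1)%N /\
                  G^`(1) \proper two_step_centralizer j) s.

Definition is_defect (e s k : nat) : Prop :=
  (k <= 1)%N /\
  [~: two_step_centralizer s, 'L_e(G)] = 'L_(nilpotency_index - k)(G).

Definition normalized_generators (s : nat) (x y : gT) : Prop :=
  [/\ G :=: <<[set x; y]>>,
      'L_3(G) = <<[set y ^+ 3; x ^+ 3] :|: 'L_4(G)>>,
      (s < nilpotency_index.-1)%N -> x \in G :\: two_step_centralizer s
    & y \in two_step_centralizer s :\: G^`(1)].

End Invariants.

Local Open Scope ring_scope.

Section Annihilator.

Variables (gT : finGroupType) (G : {group gT}) (abG' : abelian G^`(1)%g).
Variables (x y : gT).

Local Notation M := (fmod_of abG').

(* The action of g - 1 on the Z[G]-module G'; multiplicatively,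
   t |-> [~ t, g]. *)
Definition act_sub1 (g : gT) (u : M) : M := u ^@ g - u.

(* The action of f(x - 1, y - 1) for f in Z[X, Y], where X is 'X_0, Y is 'X_1. *)
Definition act_mpoly (f : {mpoly int[2]}) (u : M) : M :=
  \sum_(m <- msupp f)
     iter (m ord0) (act_sub1 x) (iter (m ord_max) (act_sub1 y) u) *~ f@_m.

Lemma act_mpolyE k f u : (msize f <= k)%N ->
  act_mpoly f u =
  \sum_(m : 'X_{1..2 < k})
     iter (m ord0) (act_sub1 x) (iter (m ord_max) (act_sub1 y) u) *~ f@_m.
Proof.
move=> le_fk; rewrite /act_mpoly (big_mksub 'X_{1..2 < k}) //=; first last.
- by move=> m /msize_mdeg_lt /leq_trans; apply.
- by rewrite msupp_uniq.
by rewrite big_rmcond //= => m /memN_msupp_eq0 ->; rewrite mulr0z.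
Qed.

Lemma act_mpolyB u : {morph act_mpoly^~ u : f g / f - g}.
Proof.
move=> f g /=; pose k := maxn (msize (f - g)) (maxn (msize f) (msize g)).
rewrite !(@act_mpolyE k) ?leq_max ?leqnn ?orbT // -sumrB.
by apply: eq_bigr => m _; rewrite mcoeffB mulrzBr.
Qed.

Definition annihilator : {pred {mpoly int[2]}} :=
  [pred f | act_mpoly f (fmod abG' [~ y, x]%g) == 0].

Lemma annihilator_zmod_closed : zmod_closed annihilator.
Proof.
split=> [|f g]; first by rewrite inE /act_mpoly msupp0 big_nil.
by rewrite !inE act_mpolyB => /eqP-> /eqP->; rewrite subr0.
Qed.

HB.instance Definition _ :=
  GRing.isZmodClosed.Build {mpoly int[2]} annihilator annihilator_zmod_closed.

Lemma act_sub1B g : {morph act_sub1 g : u v / u - v}.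
Proof. by move=> u v; rewrite /act_sub1 actAr actNr opprD addrACA -opprD. Qed.

HB.instance Definition _ g := GRing.isZmodMorphism.Build M M (act_sub1 g) (act_sub1B g).

Lemma act_sub1C : x \in G -> y \in G -> forall u,
  act_sub1 x (act_sub1 y u) = act_sub1 y (act_sub1 x u).
Proof.
move=> Gx Gy u; rewrite /act_sub1 !actAr !actNr.
have nG' z : z \in G -> z \in 'N(G^`(1))%g by apply/subsetP/der_norm.
suff ->: u ^@ y ^@ x = u ^@ x ^@ y.
  by rewrite !opprB addrACA [RHS]addrACA; congr (_ + _); rewrite addrC.
rewrite -!actrM ?nG' // (commgC x y) [RHS]actrM ?nG' ?groupR ?groupM //.
apply: val_inj; rewrite [RHS]fmvalJ ?nG' ?groupR //; apply/esym/conjg_fixP/commgP.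
by apply: (centsP abG'); rewrite ?fmodP // mem_commg.
Qed.

Lemma act_mpoly0 u : act_mpoly 0 u = 0.
Proof. by rewrite -(subrr 0) act_mpolyB subrr. Qed.

Lemma act_mpolyD u : {morph act_mpoly^~ u : f g / f + g}.
Proof.
move=> f g; rewrite -[g in f + g]opprK -[- g]sub0r !act_mpolyB act_mpoly0.
by rewrite sub0r opprK.
Qed.

Lemma act_mpolyMX u c m : act_mpoly (c *: 'X_[m]) u =
  iter (m ord0) (act_sub1 x) (iter (m ord_max) (act_sub1 y) u) *~ c.
Proof.
have [->|nz_c] := eqVneq c 0; first by rewrite scale0r act_mpoly0.
by rewrite /act_mpoly msuppMCX // big_seq1 mcoeffZ mcoeffX eqxx mulr1.
Qed.

Lemma act_mpoly_is_additive f : {morph act_mpoly f : u v / u - v}.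
Proof.
have iterB n g : {morph iter n (act_sub1 g) : u v / u - v}.
  by elim: n => // n IHn u v; rewrite /= IHn act_sub1B.
by move=> u v; rewrite /act_mpoly -sumrB; apply: eq_bigr => m _;
   rewrite !iterB mulrzBl.
Qed.

HB.instance Definition _ f :=
  GRing.isZmodMorphism.Build M M (act_mpoly f) (act_mpoly_is_additive f).

Lemma act_mpolyM : x \in G -> y \in G -> forall f g u,
  act_mpoly (f * g) u = act_mpoly f (act_mpoly g u).
Proof.
move=> Gx Gy f g u; elim/mpolyind: f => [|c m f _ _ IHf].
  by rewrite mul0r !act_mpoly0.
rewrite mulrDl !act_mpolyD {}IHf; congr (_ + _).
elim/mpolyind: g => [|d m' g _ _ IHg]; first by rewrite mulr0 !act_mpoly0 raddf0.
rewrite mulrDr !act_mpolyD raddfD /= {}IHg; congr (_ + _).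
rewrite -scalerAl -scalerAr scalerA -mpolyXD !act_mpolyMX !mnmDE.
have iterMz n z v (k : int) :
    iter n (act_sub1 z) (v *~ k) = iter n (act_sub1 z) v *~ k.
  by elim: n => //= n ->; rewrite raddfMz.
have iterC n k v : iter n (act_sub1 x) (iter k (act_sub1 y) v)
                 = iter k (act_sub1 y) (iter n (act_sub1 x) v).
  elim: n v => // n IHn v; rewrite !iterSr -IHn; congr (iter n _ _).
  by elim: k {IHn} => //= k <-; rewrite act_sub1C.
by rewrite !iterMz -mulrzA [d * c]mulrC !iterD -[in RHS]iterC.
Qed.

(* The annihilator is an ideal, so that {ideal_quot annihilator} is the
   additive group of a residue class ring. *)
Lemma annihilator_ideal : x \in G -> y \in G ->
  forall f g, g \in annihilator -> f * g \in annihilator.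
Proof.
by move=> Gx Gy f g; rewrite !inE act_mpolyM // => /eqP ->; rewrite raddf0.
Qed.

End Annihilator.

(* A(3, mu), additively, for mu >= 2: both exponents are then positive, so
   that both factors are the expected groups Z/3^a. *)
Notation nearly_homocyclic3 mu :=
  ('Z_(3 ^ uphalf mu) * 'Z_(3 ^ mu./2))%type.

Definition isomorphic_add (U V : zmodType) : Prop :=
  exists f : {additive U -> V}, bijective f.

(* Main.v *)
Require Import Defs.
From HB Require Import structures.
From mathcomp Require Import all_boot all_order all_algebra.
From mathcomp Require Import all_fingroup all_solvable.
From mathcomp Require Import ring_quotient.
From mathcomp.multinomials Require Import mpoly.
From mathcomp Require Import ring zify.

Set Implicit Arguments.
Unset Strict Implicit.
Unset Printing Implicit Defensive.

Import GRing.Theory FiniteModule.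

(** The commutator subgroup M = G', written additively, is a module over
Z[X, Y], where X and Y act as x - 1 and y - 1, and it is generated by the single
element s = [y, x].  So M is a quotient ring K of Z[X, Y], with 1 = s, and the
lower central series is the filtration by the powers of the ideal (X, Y):
the term of index j + 2 is (X, Y)^j ([commutator_ring], [lcn_augpow]).

All that is needed from G beyond this are the two cubes sigma = y^3 and
tau = x^3, which lie in G'.  Commuting them with x and y gives
  Y sigma = 0,  X tau = 0,
  X sigma = Y^2 + 3 Y + 3,  Y tau = - (X^2 + 3 X + 3).
Since the factors of the lower central series of index 3 and 4 have order
greater than 3, the generators can be chosen such that sigma and tau span the
factor of index 3 ([ex_independent_generators]).  By nilpotency, the ideal (X, Y)
is then K sigma + K tau.  Writing X and Y themselves in terms of sigma and tau
shows that (X^2 + 3 X + 3) sigma and (Y^2 + 3 Y + 3) tau vanish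
([cube_relations]).  As T^2 + 3 T + 3 is the minimal polynomial of omega - 1, for
a primitive third root of unity omega, both K sigma and K tau are cyclic modules
over the Eisenstein integers, hence nearly homocyclic, and 3 acts on them like a
unit times the square of omega - 1 ([three_power_annihilates]).  A relation
3 = X sigma - (Y + 3) k tau shows that 1, sigma, tau and Y tau generate the
group K.  Modulo K tau it reads 3 = X sigma, so that 1 behaves like a quotient
of sigma by omega - 1 up to a unit, and the exponent m - 3 of omega - 1 which
kills sigma grows to m - 2 ([additive_generators]).

The vanishing of the defect enters through an element outside G' which
centralizes the term of index e of the lower central series; it forces
X^(e - 2) sigma = 0 or Y^(e - 2) tau = 0 ([defect_kills]), and by the symmetry
between x and y one may assume the latter.  Thus G' is an image of
A(3, m - 2) + A(3, e - 2).  Conversely, the orders of the factors of the lower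
central series bound the order of G' below by 3^(m - 2 + e - 2)
([card_der1_lower_bound]), so this surjection is an isomorphism.  The rank is read off
from the elements of order dividing 3, and G' cannot be elementary because its
rank 4 is less than the logarithm m + e - 4 of its order. *)

(** * Powers of the ideal generated by two elements *)

Local Open Scope ring_scope.

Lemma int_mod3 (a : int) :
  exists q : int, [\/ a = 3 * q, a = 3 * q + 1 | a = 3 * q - 1].
Proof.
suff [q [->|[->|->]]]: exists q : int,
    a = 3 * q \/ (a = 3 * q + 1 \/ a = 3 * q - 1).
- by exists q; constructor 1.
- by exists q; constructor 2.
- by exists q; constructor 3.
exists ((a + 1) %/ 3)%Z; lia.
Qed.

Section AugmentationPowers.

Variables (K : comNzRingType) (X Y : K).

(** The j-th power of the ideal (X, Y), presented so that the passage from
[i] to [i.+1] is the one from a term L of the lower central series to [L, G]. *)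
Fixpoint augpow (j : nat) (z : K) : Prop :=
  if j is i.+1 then
    exists g h, [/\ augpow i g, augpow i h & z = X * g + Y * h]
  else True.

Definition cyclic_factor (j : nat) : Prop :=
  exists2 v, augpow j v &
    forall z, augpow j z -> exists i : int, augpow j.+1 (z - i%:~R * v).

(** K is generated by X and Y as a ring, as an induction principle. *)
Definition ring_generated : Prop :=
  forall P : K -> Prop,
    P 1 -> (forall a b, P a -> P b -> P (a - b)) ->
    (forall a, P a -> P (X * a)) -> (forall a, P a -> P (Y * a)) ->
  forall z, P z.

Lemma augpow0 j : augpow j 0.
Proof. by elim: j => //= j IH; exists 0, 0; split=> //; ring. Qed.

Lemma augpowD j a b : augpow j a -> augpow j b -> augpow j (a + b).
Proof.
elim: j a b => //= j IH a b [g [h [Ag Ah ->]]] [g' [h' [Ag' Ah' ->]]].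
by exists (g + g'), (h + h'); split; [exact: IH|exact: IH|ring].
Qed.

Lemma augpowM j c a : augpow j a -> augpow j (c * a).
Proof.
elim: j a => //= j IH a [g [h [Ag Ah ->]]].
by exists (c * g), (c * h); split; [exact: IH|exact: IH|ring].
Qed.

Lemma augpowN j a : augpow j a -> augpow j (- a).
Proof. by rewrite -mulN1r; apply: augpowM. Qed.

Lemma augpowB j a b : augpow j a -> augpow j b -> augpow j (a - b).
Proof. by move=> Aa Ab; apply/augpowD/augpowN. Qed.

Lemma augpowS j a : augpow j.+1 a -> augpow j a.
Proof.
elim: j a => // j IH a [g [h [Ag Ah ->]]].
by exists g, h; split=> //; apply: IH.
Qed.

Lemma augpow_le i j a : (i <= j)%N -> augpow j a -> augpow i a.
Proof. by move/subnK<-; elim: (j - i)%N => // k IH /augpowS/IH. Qed.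

Lemma augpowX j a : augpow j a -> augpow j.+1 (X * a).
Proof. by move=> Aa; exists a, 0; split=> //; [exact: augpow0 | ring]. Qed.

Lemma augpowY j a : augpow j a -> augpow j.+1 (Y * a).
Proof. by move=> Aa; exists 0, a; split=> //; [exact: augpow0 | ring]. Qed.

Lemma augpow_mul i j a b : augpow i a -> augpow j b -> augpow (i + j) (a * b).
Proof.
elim: i a => [|i IH] a; first by move=> _; apply: augpowM.
move=> [g [h [Ag Ah ->]]] Ab; rewrite addSn.
exists (g * b), (h * b); split; [exact: IH | exact: IH | ring].
Qed.

Lemma augpow_exp n a : augpow 1 a -> augpow n (a ^+ n).
Proof.
move=> Aa; elim: n => // n IH; rewrite exprS -add1n; exact: augpow_mul.
Qed.

Lemma augpow_X1 : augpow 1 X.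
Proof. by exists 1, 0; split=> //; ring. Qed.

Lemma augpow_Y1 : augpow 1 Y.
Proof. by exists 0, 1; split=> //; ring. Qed.

Lemma augpow_eq j a b : a = b -> augpow j b -> augpow j a.
Proof. by move->. Qed.

End AugmentationPowers.

(** Memberships below come from explicit linear combinations of known elements
of the ideal; [augby e] rewrites the element as the combination [e]. *)
Ltac aug := repeat first [assumption | apply: augpowD | apply: augpowN
                         | apply: augpowM].
Ltac augby e := apply: (@augpow_eq _ _ _ _ _ e); [subst; ring | aug].

Section SmallFactors.

Variables (K : comNzRingType) (X Y : K).
Local Notation augpow := (augpow X Y).
Local Notation cyclic_factor := (cyclic_factor X Y).
Hypothesis genK : ring_generated X Y.

Lemma const_coef z : exists i : int, augpow 1 (z - i%:~R).
Proof.
move: z; apply: genK => [|a b [i Ai] [j Aj]|a _|a _].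
- by exists 1; rewrite mulr1z subrr; apply: augpow0.
- exists (i - j); augby ((a - i%:~R) + - (b - j%:~R)).
- by exists 0; rewrite subr0; apply: augpowX.
- by exists 0; rewrite subr0; apply: augpowY.
Qed.

Lemma linear_part z : augpow 1 z ->
  exists a b : int, augpow 2 (z - (a%:~R * X + b%:~R * Y)).
Proof.
move=> [g [h [_ _ ->]]]; have [a Aa] := const_coef g; have [b Ab] := const_coef h.
exists a, b; apply: (@augpow_eq _ _ _ _ _
  (X * (g - a%:~R) + Y * (h - b%:~R))); first by ring.
by apply: augpowD; [apply: augpowX | apply: augpowY].
Qed.

Lemma quadratic_part z : augpow 2 z -> exists a b c : int,
  augpow 3 (z - (a%:~R * X ^+ 2 + b%:~R * (X * Y) + c%:~R * Y ^+ 2)).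
Proof.
move=> [g [h [Ag Ah ->]]].
have [a [b Aab]] := linear_part Ag; have [c [d Acd]] := linear_part Ah.
exists a, (b + c), d; apply: (@augpow_eq _ _ _ _ _
  (X * (g - (a%:~R * X + b%:~R * Y)) + Y * (h - (c%:~R * X + d%:~R * Y)))).
  by ring.
by apply: augpowD; [apply: augpowX | apply: augpowY].
Qed.

Lemma cyclic_factor1 v (a b : int) : augpow 1 v ->
  augpow 2 (X - a%:~R * v) -> augpow 2 (Y - b%:~R * v) -> cyclic_factor 1.
Proof.
move=> Av AX AY; exists v => // z /linear_part[c [d Az]].
exists (c * a + d * b).
augby (z - (c%:~R * X + d%:~R * Y)
  + (c%:~R * (X - a%:~R * v) + d%:~R * (Y - b%:~R * v))).
Qed.

Lemma cyclic_factor2 v (a b c : int) : augpow 2 v ->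
  augpow 3 (X ^+ 2 - a%:~R * v) -> augpow 3 (X * Y - b%:~R * v) ->
  augpow 3 (Y ^+ 2 - c%:~R * v) -> cyclic_factor 2.
Proof.
move=> Av AX AXY AY; exists v => // z /quadratic_part[d [e [f Az]]].
exists (d * a + e * b + f * c).
augby (z - (d%:~R * X ^+ 2 + e%:~R * (X * Y) + f%:~R * Y ^+ 2) + (d%:~R * (X ^+ 2 - a%:~R * v) + e%:~R * (X * Y - b%:~R * v) + f%:~R * (Y ^+ 2 - c%:~R * v))).
Qed.

Hypothesis aug3 : augpow 1 3.
Hypothesis ncyc1 : ~ cyclic_factor 1.

Lemma augpow3 j z : augpow j z -> augpow j.+1 (3 * z).
Proof. by move=> Az; apply: (augpow_mul aug3). Qed.

(** A relation between X and Y with a coefficient prime to 3 would make the first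
factor cyclic, since 3 lies in the ideal. *)
Lemma XY_independent (a b : int) : augpow 2 (a%:~R * X + b%:~R * Y) ->
  (exists a' : int, a = 3 * a') /\ (exists b' : int, b = 3 * b').
Proof.
move=> Aab; have A3X := augpow3 (augpow_X1 X Y).
have A3Y := augpow3 (augpow_Y1 X Y).
have [q Db] := int_mod3 b; have [p Da] := int_mod3 a.
have goodX c : augpow 2 (Y - c%:~R * X) -> cyclic_factor 1.
  apply: (@cyclic_factor1 X 1); first exact: augpow_X1.
  by rewrite mul1r subrr; apply: augpow0.
have goodY : augpow 2 X -> cyclic_factor 1.
  move=> AX; apply: (@cyclic_factor1 Y 0 1); first exact: augpow_Y1.
    by rewrite mul0r subr0.
  by rewrite mul1r subrr; apply: augpow0.
case: Db => Db.
- case: Da => Da; first by split; [exists p | exists q].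
  + case: ncyc1; apply: goodY; augby (a%:~R * X + b%:~R * Y + - (p%:~R * (3 * X)) + - (q%:~R * (3 * Y))).
  + case: ncyc1; apply: goodY; augby (- (a%:~R * X + b%:~R * Y) + (p%:~R * (3 * X)) + (q%:~R * (3 * Y))).
- case: ncyc1; apply: (goodX (- a)).
  augby (a%:~R * X + b%:~R * Y + - (q%:~R * (3 * Y))).
- case: ncyc1; apply: (goodX a).
  augby (- (a%:~R * X + b%:~R * Y) + (q%:~R * (3 * Y))).
Qed.

(** If the constant term of c were prime to 3, then P c = 0 would put the linear
part of P into the square of the ideal. *)
Lemma annihilated_deep P c (a b : int) :
  augpow 2 (P - (a%:~R * X + b%:~R * Y)) -> P * c = 0 ->
  ~ ((exists a' : int, a = 3 * a') /\ (exists b' : int, b = 3 * b')) -> augpow 1 c.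
Proof.
move=> AP Pc0 nab; have [k Ac] := const_coef c.
have [q Dk] := int_mod3 k.
have A1 : augpow 1 (a%:~R * X + b%:~R * Y).
  by aug; [exact: augpow_X1 | exact: augpow_Y1].
have A3 := augpow3 A1.
have Akab : augpow 2 (k%:~R * (a%:~R * X + b%:~R * Y)).
  apply: (@augpow_eq _ _ _ _ _ (P * c - k%:~R * (P - (a%:~R * X + b%:~R * Y))
    - ((c - k%:~R) * (P - (a%:~R * X + b%:~R * Y))
       + (c - k%:~R) * (a%:~R * X + b%:~R * Y)))); first by ring.
  rewrite Pc0 sub0r; apply: augpowB; first by aug.
  by apply: augpowD; [aug | apply: (augpow_mul Ac)].
case: Dk => Dk.
- augby (c - k%:~R + q%:~R * 3).
- case: nab; apply: XY_independent.
  augby (k%:~R * (a%:~R * X + b%:~R * Y) + - (q%:~R * (3 * (a%:~R * X + b%:~R * Y)))).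
- case: nab; apply: XY_independent.
  augby (- (k%:~R * (a%:~R * X + b%:~R * Y)) + (q%:~R * (3 * (a%:~R * X + b%:~R * Y)))).
Qed.

End SmallFactors.

(** * Choosing generators with independent cubes *)

(** The leading term of the trace Z^2 + 3 Z + 3 of a group element with Z as its
difference to 1: 3 already lies in the square of the ideal, so that only
L^2 + 3 survives modulo the cube, where L is the linear part of Z. *)
Lemma augpow_trace (K : comNzRingType) (X Y Z L u : K) :
  augpow X Y 2 3 -> augpow X Y 1 Z -> augpow X Y 1 (u - 1) ->
  augpow X Y 2 (Z - L) -> augpow X Y 3 ((Z ^+ 2 + 3 * Z + 3) * u) ->
  augpow X Y 3 (L ^+ 2 + 3).
Proof.
move=> A3 AZ Au AZL AW.
have A33 : augpow X Y 3 (3 * Z) := augpow_mul A3 AZ.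
apply: (@augpow_eq _ _ _ _ _ ((Z ^+ 2 + 3 * Z + 3) * u
  - ((u - 1) * (Z ^+ 2 + 3 * Z + 3) + 3 * Z + (Z - L) * (Z + L)))).
  by ring.
apply: augpowB => //; apply: augpowD; last first.
  apply: (@augpow_mul _ _ _ 2 1) => //; have AZL1 := augpowS AZL.
  by augby (Z + Z - (Z - L)).
apply: augpowD => //; apply: (@augpow_mul _ _ _ 1 2) => //.
apply: augpowD => //; apply: augpowD; last exact: augpowS.
exact: augpow_exp.
Qed.

Section IndependentCubes.

Variables (K : comNzRingType) (X Y tau : K).
Local Notation augpow := (augpow X Y).
Hypothesis genK : ring_generated X Y.
Hypothesis aug3 : augpow 1 3.
Hypothesis ncyc1 : ~ cyclic_factor X Y 1.
Hypothesis ncyc2 : ~ cyclic_factor X Y 2.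
Hypothesis Xtau : X * tau = 0.
Hypothesis tau_shallow : ~ augpow 2 tau.

Definition spans_factor1 (c d : K) : Prop := forall z, augpow 1 z ->
  exists a b : int, augpow 2 (z - (a%:~R * c + b%:~R * d)).

Lemma tau_deep : augpow 1 tau.
Proof.
apply: (annihilated_deep genK aug3 ncyc1 (P := X) (a := 1) (b := 0)) => //.
  by augby (0 : K); apply: augpow0.
by case=> -[q Dq]; lia.
Qed.

(** If both X and Y killed tau modulo the cube of the ideal, the linear part of
tau would give two independent relations among X^2, X Y and Y^2. *)
Lemma Ytau_shallow : ~ augpow 3 (Y * tau).
Proof.
move=> AYtau; have [c [d Ac]] := linear_part genK tau_deep.
have A2X2 : augpow 2 (X * X) by apply/augpowX/augpow_X1.
have A2XY : augpow 2 (X * Y) by apply/augpowX/augpow_Y1.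
have A2Y2 : augpow 2 (Y * Y) by apply/augpowY/augpow_Y1.
have A3X2 := augpow3 aug3 A2X2.
have A3XY := augpow3 aug3 A2XY; have A3Y2 := augpow3 aug3 A2Y2.
have A3X := augpow3 aug3 (augpow_X1 X Y).
have A3Y := augpow3 aug3 (augpow_Y1 X Y).
have AX : augpow 3 (c%:~R * (X * X) + d%:~R * (X * Y)).
  apply: (@augpow_eq _ _ _ _ _
    (X * tau - X * (tau - (c%:~R * X + d%:~R * Y)))); first by ring.
  by rewrite Xtau sub0r; apply/augpowN/augpowX.
have AY : augpow 3 (c%:~R * (X * Y) + d%:~R * (Y * Y)).
  apply: (@augpow_eq _ _ _ _ _
    (Y * tau - Y * (tau - (c%:~R * X + d%:~R * Y)))); first by ring.
  by apply: augpowB => //; apply: augpowY.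
have [p Dc] := int_mod3 c; case: Dc => Dc.
- have [q Dd] := int_mod3 d; case: Dd => Dd.
  + apply: tau_shallow.
    augby (tau - (c%:~R * X + d%:~R * Y) + (p%:~R * (3 * X) + q%:~R * (3 * Y))).
  + apply: ncyc2; apply: (@cyclic_factor2 _ _ _ genK (X * X) 1 0 0) => //.
    * by augby (0 : K); apply: augpow0.
    * augby (c%:~R * (X * X) + d%:~R * (X * Y) + - (p%:~R * (3 * (X * X)))
             + - (q%:~R * (3 * (X * Y)))).
    * augby (c%:~R * (X * Y) + d%:~R * (Y * Y) + - (p%:~R * (3 * (X * Y)))
             + - (q%:~R * (3 * (Y * Y)))).
  + apply: ncyc2; apply: (@cyclic_factor2 _ _ _ genK (X * X) 1 0 0) => //.
    * by augby (0 : K); apply: augpow0.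
    * augby (- (c%:~R * (X * X) + d%:~R * (X * Y)) + (p%:~R * (3 * (X * X)))
             + (q%:~R * (3 * (X * Y)))).
    * augby (- (c%:~R * (X * Y) + d%:~R * (Y * Y)) + (p%:~R * (3 * (X * Y)))
             + (q%:~R * (3 * (Y * Y)))).
- apply: ncyc2.
  apply: (@cyclic_factor2 _ _ _ genK (Y * Y) (d * d) (- d) 1) => //.
  + augby (c%:~R * (X * X) + d%:~R * (X * Y) + - (p%:~R * (3 * (X * X)))
     + - (d%:~R * (c%:~R * (X * Y) + d%:~R * (Y * Y)))
     + d%:~R * (p%:~R * (3 * (X * Y)))).
  + augby (c%:~R * (X * Y) + d%:~R * (Y * Y) + - (p%:~R * (3 * (X * Y)))).
  + by augby (0 : K); apply: augpow0.
- apply: ncyc2.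
  apply: (@cyclic_factor2 _ _ _ genK (Y * Y) (d * d) d 1) => //.
  + augby (- (c%:~R * (X * X) + d%:~R * (X * Y)) + (p%:~R * (3 * (X * X)))
     + - (d%:~R * (c%:~R * (X * Y) + d%:~R * (Y * Y)))
     + d%:~R * (p%:~R * (3 * (X * Y)))).
  + augby (- (c%:~R * (X * Y) + d%:~R * (Y * Y)) + (p%:~R * (3 * (X * Y)))).
  + by augby (0 : K); apply: augpow0.
Qed.

(** Here tau and sigma are the cubes of x and of a second generator; the
difference of the latter to 1 is P. *)
Lemma spans_or_deep P sigma (k : int) :
  augpow 2 (P - (k%:~R * X + Y)) -> P * sigma = 0 ->
  spans_factor1 sigma tau \/ augpow 2 sigma.
Proof.
move=> AP Psigma; have A1tau := tau_deep.
have [AP1 X1 Y1] := And3 (augpowS AP) (augpow_X1 X Y) (augpow_Y1 X Y).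
have A1sigma : augpow 1 sigma.
  apply: (annihilated_deep genK aug3 ncyc1 (P := P) (a := k) (b := 1)) => //.
    augby (P - (k%:~R * X + Y)).
  by case=> _ [q Dq]; lia.
have [a [b Asig]] := linear_part genK A1sigma.
have [c [d Atau]] := linear_part genK A1tau.
have A3X := augpow3 aug3 (augpow_X1 X Y).
have A3Y := augpow3 aug3 (augpow_Y1 X Y).
have A3sig := augpow3 aug3 A1sigma.
have A3tau := augpow3 aug3 A1tau.
have A2Psig : augpow 3 (P * sigma) by rewrite Psigma; apply: augpow0.
(* If sigma is a nonzero multiple of tau modulo the square, then P, and hence
   Y, kills tau modulo the cube. *)
have multiple (t : int) : augpow 2 (sigma - t%:~R * tau) -> augpow 2 sigma.
  move=> At; have AYt u : augpow 2 (tau - u%:~R * sigma) -> augpow 3 (Y * tau).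
    move=> Au; apply: (@augpow_eq _ _ _ _ _ (P * (tau - u%:~R * sigma)
      + u%:~R * (P * sigma) - (P - (k%:~R * X + Y)) * tau - k%:~R * (X * tau))).
      by ring.
    rewrite Xtau mulr0 subr0; apply: augpowB.
      apply: augpowD; last by aug.
      apply: (@augpow_mul _ _ _ 1 2) => //.
      by augby (P - (k%:~R * X + Y) + (k%:~R * X + Y)).
    exact: (@augpow_mul _ _ _ 2 1).
  have [q Dt] := int_mod3 t; case: Dt => Dt.
  - augby (sigma - t%:~R * tau + q%:~R * (3 * tau)).
  - case: Ytau_shallow; apply: (AYt 1).
    augby (- (sigma - t%:~R * tau) + - (q%:~R * (3 * tau))).
  - case: Ytau_shallow; apply: (AYt (- 1)).
    augby ((sigma - t%:~R * tau) + (q%:~R * (3 * tau))).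
have [D DD] : exists D, D = a * d - b * c by eexists.
have AX : augpow 2 (D%:~R * X - (d%:~R * sigma - b%:~R * tau)).
  augby (- (d%:~R * (sigma - (a%:~R * X + b%:~R * Y)))
         + b%:~R * (tau - (c%:~R * X + d%:~R * Y))).
have AY : augpow 2 (D%:~R * Y - (a%:~R * tau - c%:~R * sigma)).
  augby (c%:~R * (sigma - (a%:~R * X + b%:~R * Y))
         + - (a%:~R * (tau - (c%:~R * X + d%:~R * Y)))).
have [q DDq] := int_mod3 D; clear DD; case: DDq => DDq; last first.
- left=> z /(linear_part genK)[i [j Az]].
  exists (- i * d + j * c), (i * b - j * a).
  augby (z - (i%:~R * X + j%:~R * Y)
    + - (i%:~R * (D%:~R * X - (d%:~R * sigma - b%:~R * tau)))
    + - (j%:~R * (D%:~R * Y - (a%:~R * tau - c%:~R * sigma)))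
    + i%:~R * (q%:~R * (3 * X)) + j%:~R * (q%:~R * (3 * Y))).
- left=> z /(linear_part genK)[i [j Az]].
  exists (i * d - j * c), (- i * b + j * a).
  augby (z - (i%:~R * X + j%:~R * Y)
    + (i%:~R * (D%:~R * X - (d%:~R * sigma - b%:~R * tau)))
    + (j%:~R * (D%:~R * Y - (a%:~R * tau - c%:~R * sigma)))
    + - (i%:~R * (q%:~R * (3 * X))) + - (j%:~R * (q%:~R * (3 * Y)))).
right; have [p Dc] := int_mod3 c; case: Dc => Dc.
- have [r Dd] := int_mod3 d; case: Dd => Dd.
  + case: tau_shallow; augby (tau - (c%:~R * X + d%:~R * Y)
      + (p%:~R * (3 * X) + r%:~R * (3 * Y))).
  + apply: (multiple b).
    augby (- (D%:~R * X - (d%:~R * sigma - b%:~R * tau))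
      + q%:~R * (3 * X) + - (r%:~R * (3 * sigma))).
  + apply: (multiple (- b)).
    augby ((D%:~R * X - (d%:~R * sigma - b%:~R * tau))
      + - (q%:~R * (3 * X)) + (r%:~R * (3 * sigma))).
- apply: (multiple a).
  augby ((D%:~R * Y - (a%:~R * tau - c%:~R * sigma))
      + - (q%:~R * (3 * Y)) + - (p%:~R * (3 * sigma))).
- apply: (multiple (- a)).
  augby (- (D%:~R * Y - (a%:~R * tau - c%:~R * sigma))
      + (q%:~R * (3 * Y)) + (p%:~R * (3 * sigma))).
Qed.

Variable sigma : nat -> K.
Let Z i : K := (1 + Y) * (1 + X) ^+ i - 1.
Hypothesis Zsigma : forall i, Z i * sigma i = 0.
Hypothesis Xsigma : forall i,
  X * sigma i = (Z i ^+ 2 + 3 * Z i + 3) * (1 + X) ^+ i.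

(** Here [sigma i] stands for the cube of the generator y x^i, and [Z i] for
y x^i - 1.  If none of the three cubes for i < 3 is independent of tau, then all
three lie in the square of the ideal, and X [sigma i] = 0 modulo the cube of the ideal gives the relations
(i X + Y)^2 + 3 = 0 there, which make the second factor cyclic. *)
Lemma ex_independent_cubes : exists i, spans_factor1 (sigma i) tau.
Proof.
have A2X2 : augpow 2 (X * X) by apply/augpowX/augpow_X1.
have A2XY : augpow 2 (X * Y) by apply/augpowX/augpow_Y1.
have A2Y2 : augpow 2 (Y * Y) by apply/augpowY/augpow_Y1.
have [X1 Y1] := (augpow_X1 X Y, augpow_Y1 X Y).
have AZ0 : augpow 2 (Z 0 - (0%:~R * X + Y)).
  by rewrite /Z; augby (0 : K); apply: augpow0.
have [|A0] := spans_or_deep AZ0 (Zsigma 0); first by exists 0%N.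
have AZ1 : augpow 2 (Z 1 - (1%:~R * X + Y)) by rewrite /Z; augby (X * Y).
have [|A1] := spans_or_deep AZ1 (Zsigma 1); first by exists 1%N.
have AZ2 : augpow 2 (Z 2 - (2%:~R * X + Y)).
  by rewrite /Z; augby ((1 + Y) * (X * X) + 2 * (X * Y)).
have [|A2] := spans_or_deep AZ2 (Zsigma 2); first by exists 2.
(* Otherwise the cubes of y, y x and y x ^ 2 all lie in the square of the
   ideal, which makes X ^ 2 and X * Y vanish modulo its third power. *)
case: ncyc2.
have {}A0 := augpowX A0; have {}A1 := augpowX A1; have {}A2 := augpowX A2.
have A3Y := augpow3 aug3 Y1.
have A23 : augpow 2 3.
  apply: (@augpow_eq _ _ _ _ _ (X * sigma 0 - (3 * Y + Y * Y))).
    by rewrite Xsigma /Z; ring.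
  by apply: augpowB; [exact: augpowS | aug].
have AZ i : augpow 1 (Z i).
  have -> : Z i = Y * (1 + X) ^+ i + ((1 + X) ^+ i - 1) by rewrite /Z; ring.
  apply: augpowD; first by rewrite mulrC; aug.
  by rewrite subrX1 addrC addKr mulrC; aug.
have W i (k : int) : augpow 2 (Z i - (k%:~R * X + Y)) ->
    augpow 3 (X * sigma i) -> augpow 3 ((k%:~R * X + Y) ^+ 2 + 3).
  move=> AZi; rewrite Xsigma; apply: (augpow_trace A23 (AZ i) _ AZi).
  by rewrite subrX1 addrC addKr mulrC; aug.
have [{}A0 {}A1 {}A2] := And3 (W _ _ AZ0 A0) (W _ _ AZ1 A1) (W _ _ AZ2 A2).
have [A3X2 A3XY] := conj (augpow3 aug3 A2X2) (augpow3 aug3 A2XY).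
have AXX : augpow 3 (X * X).
  augby (3 * (X * X) + - ((2%:~R * X + Y) ^+ 2 + 3)
    + 2 * ((1%:~R * X + Y) ^+ 2 + 3) + - ((0%:~R * X + Y) ^+ 2 + 3)).
have AXY : augpow 3 (X * Y).
  augby (3 * (X * Y) + X * X + - ((1%:~R * X + Y) ^+ 2 + 3)
    + ((0%:~R * X + Y) ^+ 2 + 3)).
apply: (@cyclic_factor2 _ _ _ genK (Y * Y) 0 0 1) => //.
- by rewrite mul0r subr0.
- by rewrite mul0r subr0.
- by augby (0 : K); apply: augpow0.
Qed.

End IndependentCubes.

(** The elements sigma, tau and rho are the cubes of y, x and y x.  If all three
lie in the square of the ideal, then X^2, Y^2 and (X + Y)^2 all agree with -3 modulo the cube of the
ideal, which makes the second factor cyclic. *)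
Section DeepCubes.

Variables (K : comNzRingType) (X Y sigma tau rho : K).
Local Notation augpow := (augpow X Y).
Hypothesis genK : ring_generated X Y.
Hypothesis Xsigma : X * sigma = Y ^+ 2 + 3 * Y + 3.
Hypothesis Ytau : Y * tau = - (X ^+ 2 + 3 * X + 3).
Let Z : K := (1 + Y) * (1 + X) - 1.
Hypothesis Xrho : X * rho = (Z ^+ 2 + 3 * Z + 3) * (1 + X).

Lemma deep_cubes_cyclic :
  augpow 2 sigma -> augpow 2 tau -> augpow 2 rho -> cyclic_factor X Y 2.
Proof.
move=> As At Ar; have [X1 Y1] := (augpow_X1 X Y, augpow_Y1 X Y).
have A2X2 : augpow 2 (X * X) by apply/augpowX.
have A2XY : augpow 2 (X * Y) by apply/augpowX.
have A2Y2 : augpow 2 (Y * Y) by apply/augpowY.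
have A3s : augpow 3 (X * sigma) by apply: augpowX.
have A3t : augpow 3 (Y * tau) by apply: augpowY.
have A3 : augpow 1 3.
  have As2 := augpow_le (isT : 1 <= 3)%N A3s.
  apply: (@augpow_eq _ _ _ _ _ (X * sigma - (3 * Y + Y * Y))).
    by rewrite Xsigma; ring.
  by aug.
have A3Y := augpow3 A3 Y1.
have A23 : augpow 2 3.
  apply: (@augpow_eq _ _ _ _ _ (X * sigma - (3 * Y + Y * Y))).
    by rewrite Xsigma; ring.
  by apply: augpowB; [exact: augpowS | aug].
have BY : augpow 3 (Y ^+ 2 + 3).
  apply: (augpow_trace (Z := Y) (u := 1)) => //; rewrite ?subrr.
  - exact: augpow0.
  - exact: augpow0.
  - by rewrite mulr1 -Xsigma.
have BX : augpow 3 (X ^+ 2 + 3).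
  apply: (augpow_trace (Z := X) (u := 1)) => //; rewrite ?subrr.
  - exact: augpow0.
  - exact: augpow0.
  - by rewrite mulr1 -[_ + 3]opprK -Ytau; apply: augpowN.
have BXY : augpow 3 ((X + Y) ^+ 2 + 3).
  apply: (augpow_trace (Z := Z) (u := 1 + X)) => //.
  - by rewrite /Z; augby (X + Y + X * Y).
  - by augby X.
  - by rewrite /Z; augby (X * Y).
  - by rewrite -Xrho; apply: augpowX.
have A3XY := augpow3 A3 A2XY.
apply: (@cyclic_factor2 _ _ _ genK (X * X) 1 1 1) => //.
- by augby (0 : K); apply: augpow0.
- augby (3 * (X * Y) + - ((X + Y) ^+ 2 + 3) + (Y ^+ 2 + 3)).
- augby (Y ^+ 2 + 3 + - (X ^+ 2 + 3)).
Qed.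

End DeepCubes.

(** * Relations between the cubes *)

Section EisensteinModules.

Variables (K : comNzRingType) (X c : K).
Hypothesis trace_c : (X ^+ 2 + 3 * X + 3) * c = 0.

(** On c, the number 3 equals - X^2 - 3 X, so 3 has the weight of X^2. *)
Lemma three_power_annihilates a i j :
  X ^+ a * c = 0 -> (a <= 2 * i + j)%N -> 3 ^+ i * (X ^+ j * c) = 0.
Proof.
move=> Xa; elim: i j => [|i IHi] j.
  rewrite mul1r muln0 add0n => /subnK<-.
  by rewrite exprD -mulrA Xa mulr0.
have [k] := ubnP (a - j); elim: k j => // k IHk j ltk lea.
have [lt_aj|le_ja] := leqP a j.
  by move/subnK: lt_aj => <-; rewrite exprD -(mulrA _ _ c) Xa !mulr0.
have -> : 3 ^+ i.+1 * (X ^+ j * c) = 3 ^+ i * X ^+ j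
    * ((X ^+ 2 + 3 * X + 3) * c) - 3 ^+ i.+1 * (X ^+ j.+1 * c)
    - 3 ^+ i * (X ^+ j.+2 * c) by rewrite !exprS; ring.
rewrite trace_c (IHi j.+2); last by lia.
rewrite IHk; [by rewrite !(mulr0, subr0) | by lia | by lia].
Qed.

End EisensteinModules.

Section Structure.

Variables (K : comNzRingType) (X Y sigma tau : K).
Local Notation augpow := (augpow X Y).
Hypothesis genK : ring_generated X Y.
Hypothesis Ysigma : Y * sigma = 0.
Hypothesis Xtau : X * tau = 0.
Hypothesis Xsigma : X * sigma = Y ^+ 2 + 3 * Y + 3.
Hypothesis Ytau : Y * tau = - (X ^+ 2 + 3 * X + 3).
Hypothesis ncyc1 : ~ cyclic_factor X Y 1.
Hypothesis spans : spans_factor1 X Y sigma tau.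
Variable N : nat.
Hypothesis nilK : forall z, augpow N z -> z = 0.

Lemma augpow1_three : augpow 1 3.
Proof.
apply: (@augpow_eq _ _ _ _ _ (X * sigma - (3 * Y + Y * Y))).
  by rewrite Xsigma; ring.
have [X1 Y1] := (augpow_X1 X Y, augpow_Y1 X Y).
by apply: augpowB; [rewrite mulrC; aug | aug].
Qed.

Lemma cubes_augpow1 : augpow 1 sigma /\ augpow 1 tau.
Proof.
split.
  apply: (annihilated_deep genK augpow1_three ncyc1 (P := Y) (a := 0) (b := 1)) => //.
    by augby (0 : K); apply: augpow0.
  by case=> _ [q Dq]; lia.
apply: (annihilated_deep genK augpow1_three ncyc1 (P := X) (a := 1) (b := 0)) => //.
  by augby (0 : K); apply: augpow0.
by case=> -[q Dq]; lia.
Qed.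

Lemma X_trace0 : X * (X ^+ 2 + 3 * X + 3) = 0.
Proof. by rewrite -[_ + 3]opprK -Ytau mulrN mulrCA Xtau mulr0 oppr0. Qed.

Lemma Y_trace0 : Y * (Y ^+ 2 + 3 * Y + 3) = 0.
Proof. by rewrite -Xsigma mulrCA Ysigma mulr0. Qed.

(** The cubes span the first factor, hence every later one, and the ideal is
nilpotent. *)
Lemma span_cubes z : augpow 1 z -> exists f g, z = f * sigma + g * tau.
Proof.
have step j y : augpow j.+1 y ->
    exists f g, augpow j.+2 (y - (f * sigma + g * tau)).
  elim: j y => [|j IH] y Ay.
    by have [a [b]] := spans Ay; exists a%:~R, b%:~R.
  have [g [h [/IH[a [b Ag]] /IH[c [d Ah]] ->]]] := Ay.
  exists (X * a + Y * c), (X * b + Y * d); apply: (@augpow_eq _ _ _ _ _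
   (X * (g - (a * sigma + b * tau)) + Y * (h - (c * sigma + d * tau)))).
    by ring.
  by apply: augpowD; [apply: augpowX | apply: augpowY].
move=> Az; have [f [g Afg]] : exists f g, augpow N.+1 (z - (f * sigma + g * tau)).
  elim: N => [|n [f [g /step[f' [g' Afg]]]]].
    by exists 0, 0; rewrite !mul0r addr0 subr0.
  exists (f + f'), (g + g'); augby (z - (f * sigma + g * tau)
    - (f' * sigma + g' * tau)).
by exists f, g; apply/subr0_eq/nilK/augpowS.
Qed.

Lemma augpow1_kills u w : X * w = 0 -> Y * w = 0 -> augpow 1 u -> u * w = 0.
Proof.
move=> Xw Yw [g [h [_ _ ->]]].
by rewrite mulrDl ![_ * _ * w]mulrAC Xw Yw !mul0r addr0.
Qed.

Lemma coprime3_cancel (d : int) (w : K) :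
  (forall d' : int, d <> 3 * d') -> d%:~R * w = 0 -> w = 0.
Proof.
move=> nd dw; have [q Dd] := int_mod3 d.
have [t Dw] : exists t : int, w = 3 * t%:~R * w.
  case: Dd => Dd; first by case: (nd q).
    exists (- q); transitivity (d%:~R * w - 3 * q%:~R * w); last first.
      by rewrite dw; ring.
    by rewrite Dd; ring.
  exists q; transitivity (3 * q%:~R * w - d%:~R * w); last first.
    by rewrite dw subr0.
  by rewrite Dd; ring.
have Dwn n : w = (3 * t%:~R) ^+ n * w.
  by elim: n => [|n IH]; [rewrite mul1r | rewrite exprSr -mulrA -Dw].
rewrite (Dwn N) (nilK (z := (3 * t%:~R) ^+ N)) ?mul0r //.
by apply: augpow_exp; rewrite mulrC; apply/augpowM/augpow1_three.
Qed.

(** Multiplying X = f sigma + g tau and Y = h sigma + k tau by the traces of x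
and y gives f w + g w' = 0 and h w + k w' = 0 for the two elements w, w' to be
shown to vanish.  As X and Y kill w and w', only the constant terms of f, g, h
and k matter, and their determinant is prime to 3. *)
Lemma cube_relations : exists k,
  [/\ (X ^+ 2 + 3 * X + 3) * sigma = 0, (Y ^+ 2 + 3 * Y + 3) * tau = 0
    & 3 = X * sigma - (Y + 3) * (k * tau)].
Proof.
have [f [g DX]] := span_cubes (augpow_X1 X Y).
have [h [k DY]] := span_cubes (augpow_Y1 X Y).
have [f0 Af] := const_coef genK f; have [g0 Ag] := const_coef genK g.
have [h0 Ah] := const_coef genK h; have [k0 Ak] := const_coef genK k.
set w := (X ^+ 2 + 3 * X + 3) * sigma; set w' := (Y ^+ 2 + 3 * Y + 3) * tau.
have Xw : X * w = 0 by rewrite /w mulrA X_trace0 mul0r.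
have Yw : Y * w = 0 by rewrite /w mulrCA Ysigma mulr0.
have Yw' : Y * w' = 0 by rewrite /w' mulrA Y_trace0 mul0r.
have Xw' : X * w' = 0 by rewrite /w' mulrCA Xtau mulr0.
(* The product X * Y lies in both K * sigma and K * tau, so that X and Y kill
   it, and then so does 3 because X times the trace of x is zero. *)
have DgY : X * Y = Y * (g * tau).
  transitivity (Y * (f * sigma + g * tau)); first by rewrite -DX mulrC.
  by rewrite mulrDr mulrCA Ysigma mulr0 add0r.
have DhX : X * Y = X * (h * sigma).
  by rewrite {1}DY mulrDr [X in _ + X]mulrCA Xtau mulr0 addr0.
have XXY : X * (X * Y) = 0 by rewrite DgY mulrCA [X * _]mulrCA Xtau !mulr0.
have YXY : Y * (X * Y) = 0 by rewrite DhX mulrCA [Y * _]mulrCA Ysigma !mulr0.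
have XY3 : 3 * (X * Y) = 0.
  transitivity (X * (X ^+ 2 + 3 * X + 3) * Y - X * (X * (X * Y))
    - 3 * (X * (X * Y))); first by ring.
  by rewrite X_trace0 XXY; ring.
have g3 : 3 * (g * tau) = g * w'.
  transitivity (g * w' - 3 * (Y * (g * tau)) - Y * (Y * (g * tau))).
    by rewrite /w'; ring.
  by rewrite -DgY XY3 YXY; ring.
have h3 : 3 * (h * sigma) = h * w.
  transitivity (h * w - 3 * (X * (h * sigma)) - X * (X * (h * sigma))).
    by rewrite /w; ring.
  by rewrite -DhX XY3 XXY; ring.
have E1 : f * w + g * w' = 0.
  transitivity ((X ^+ 2 + 3 * X + 3) * (f * sigma + g * tau)); last first.
    by rewrite -DX mulrC X_trace0.
  transitivity (f * w + 3 * (g * tau) + (X + 3) * g * (X * tau)).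
    by rewrite g3 Xtau; ring.
  by rewrite /w; ring.
have E2 : h * w + k * w' = 0.
  transitivity ((Y ^+ 2 + 3 * Y + 3) * (h * sigma + k * tau)); last first.
    by rewrite -DY mulrC Y_trace0.
  transitivity (3 * (h * sigma) + k * w' + (Y + 3) * h * (Y * sigma)).
    by rewrite h3 Ysigma; ring.
  by rewrite /w'; ring.
have {}E1 : f0%:~R * w + g0%:~R * w' = 0.
  rewrite -[RHS]E1; apply/eqP; rewrite -subr_eq0 -oppr_eq0; apply/eqP.
  transitivity ((f - f0%:~R) * w + (g - g0%:~R) * w'); first by ring.
  by rewrite (augpow1_kills Xw Yw Af) (augpow1_kills Xw' Yw' Ag) addr0.
have {}E2 : h0%:~R * w + k0%:~R * w' = 0.
  rewrite -[RHS]E2; apply/eqP; rewrite -subr_eq0 -oppr_eq0; apply/eqP.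
  transitivity ((h - h0%:~R) * w + (k - k0%:~R) * w'); first by ring.
  by rewrite (augpow1_kills Xw Yw Ah) (augpow1_kills Xw' Yw' Ak) addr0.
have [A1s A1t] := cubes_augpow1.
have A2X : augpow 2 (X - (f0%:~R * sigma + g0%:~R * tau)).
  apply: (@augpow_eq _ _ _ _ _
    ((f - f0%:~R) * sigma + (g - g0%:~R) * tau)); first by rewrite [in LHS]DX; ring.
  by apply: augpowD; apply: (@augpow_mul _ _ _ 1 1).
have A2Y : augpow 2 (Y - (h0%:~R * sigma + k0%:~R * tau)).
  apply: (@augpow_eq _ _ _ _ _
    ((h - h0%:~R) * sigma + (k - k0%:~R) * tau)); first by rewrite [in LHS]DY; ring.
  by apply: augpowD; apply: (@augpow_mul _ _ _ 1 1).
(* X and Y are independent modulo the square of the ideal. *)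
have ndet (d : int) : f0 * k0 - g0 * h0 <> 3 * d.
  move=> Dd; have [A3s A3t] := conj (augpow3 augpow1_three A1s) (augpow3 augpow1_three A1t).
  have DdK : f0%:~R * k0%:~R = g0%:~R * h0%:~R + 3 * d%:~R :> K.
    by rewrite -!intrM -[3]/(3%:~R) -intrM -intrD; congr _%:~R; lia.
  have [[p Dk] [q Dg]] : (exists a' : int, k0 = 3 * a') /\
      exists b' : int, - g0 = 3 * b'.
    apply: (XY_independent genK augpow1_three ncyc1).
    apply: (@augpow_eq _ _ _ _ _ (k0%:~R * (X - (f0%:~R * sigma + g0%:~R * tau))
      - g0%:~R * (Y - (h0%:~R * sigma + k0%:~R * tau)) + d%:~R * (3 * sigma))).
      transitivity (k0%:~R * X - g0%:~R * Y - (f0%:~R * k0%:~R) * sigma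
        + (g0%:~R * h0%:~R + 3 * d%:~R) * sigma); last by ring.
      by rewrite DdK; ring.
    by aug.
  have [[r Dh] [t Df]] : (exists a' : int, - h0 = 3 * a') /\
      exists b' : int, f0 = 3 * b'.
    apply: (XY_independent genK augpow1_three ncyc1).
    apply: (@augpow_eq _ _ _ _ _ (f0%:~R * (Y - (h0%:~R * sigma + k0%:~R * tau))
      - h0%:~R * (X - (f0%:~R * sigma + g0%:~R * tau)) + d%:~R * (3 * tau))).
      transitivity (f0%:~R * Y - h0%:~R * X - (f0%:~R * k0%:~R) * tau
        + (g0%:~R * h0%:~R + 3 * d%:~R) * tau); last by ring.
      by rewrite DdK; ring.
    by aug.
  have [[u Du] _] : (exists a' : int, 1 = 3 * a') /\ exists b' : int, 0 = 3 * b'.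
    apply: (XY_independent genK augpow1_three ncyc1).
    have {}Dg : g0 = - (3 * q) by lia.
    augby (X - (f0%:~R * sigma + g0%:~R * tau) + t%:~R * (3 * sigma)
      - q%:~R * (3 * tau)).
  lia.
have Dw : (f0 * k0 - g0 * h0)%:~R * w = 0.
  transitivity (k0%:~R * (f0%:~R * w + g0%:~R * w')
    - g0%:~R * (h0%:~R * w + k0%:~R * w')); first by ring.
  by rewrite E1 E2 !mulr0 subr0.
have Dw' : (f0 * k0 - g0 * h0)%:~R * w' = 0.
  transitivity (f0%:~R * (h0%:~R * w + k0%:~R * w')
    - h0%:~R * (f0%:~R * w + g0%:~R * w')); first by ring.
  by rewrite E1 E2 !mulr0 subr0.
have w0 := coprime3_cancel ndet Dw; have w'0 := coprime3_cancel ndet Dw'.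
exists k; split=> //.
transitivity (X * sigma - (Y + 3) * (h * sigma + k * tau)).
  by rewrite -DY Xsigma; ring.
transitivity (X * sigma - (Y + 3) * (k * tau) - h * (Y * sigma)
  - 3 * (h * sigma)); first by ring.
by rewrite Ysigma h3 w0 !mulr0 !subr0.
Qed.

Definition int_spanned (t u v : K) : Prop := forall z, exists i j k l : int,
  z = i%:~R + j%:~R * t + k%:~R * u + l%:~R * v.

(** By 3 = X sigma - (Y + 3) k tau, the order of 1 divides 3 times the power of 3
that kills both terms on the right, and X sigma is a redundant generator. *)
Lemma additive_generators a b : X ^+ a * sigma = 0 -> Y ^+ b * tau = 0 ->
  (b <= a)%N ->
  [/\ 3 ^+ uphalf a.+1 = 0 :> K, 3 ^+ a.+1./2 * sigma = 0,
      3 ^+ uphalf b * tau = 0, 3 ^+ b./2 * (Y * tau) = 0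
    & int_spanned sigma tau (Y * tau)].
Proof.
move=> Xa Yb leba; have [k [trX trY D3]] := cube_relations.
have killX := three_power_annihilates trX Xa.
have killY := three_power_annihilates trY Yb.
split.
- rewrite /= exprSr {2}D3 mulrBr.
  have -> : 3 ^+ a./2 * (X * sigma) = 0.
    by rewrite -[X]expr1 killX //; lia.
  transitivity (0 - k * (3 ^+ a./2 * (Y ^+ 1 * tau)
                + 3 ^+ a./2.+1 * (Y ^+ 0 * tau))).
    by rewrite (exprS 3 a./2); ring.
  by rewrite !killY ?addr0 ?mulr0 ?subr0 //; lia.
- by rewrite -[sigma]mul1r -(expr0 X) killX //; lia.
- by rewrite -[tau]mul1r -(expr0 Y) killY //; lia.
- by rewrite -[Y]expr1 killY //; lia.
have [Kc Kc'] : (forall z, exists i j : int, z * sigma = i%:~R * sigma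
      + j%:~R * (X * sigma)) /\ (forall z, exists i j : int,
      z * tau = i%:~R * tau + j%:~R * (Y * tau)).
  split; apply: genK => [|x y [i [j Dx]] [k' [l Dy]]|x [i [j Dx]]|x [i [j Dx]]].
  - by exists 1, 0; ring.
  - by exists (i - k'), (j - l); rewrite mulrBl Dx Dy; ring.
  - exists (- 3 * j), (i - 3 * j); rewrite -mulrA Dx.
    transitivity (- 3 * j%:~R * sigma + (i%:~R - 3 * j%:~R) * (X * sigma)
      + j%:~R * ((X ^+ 2 + 3 * X + 3) * sigma)); first by ring.
    by rewrite trX; ring.
  - exists 0, 0; rewrite -mulrA Dx mulrDr !(mulrCA Y) Ysigma; ring.
  - by exists 1, 0; ring.
  - by exists (i - k'), (j - l); rewrite mulrBl Dx Dy; ring.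
  - exists 0, 0; rewrite -mulrA Dx mulrDr !(mulrCA X) Xtau; ring.
  - exists (- 3 * j), (i - 3 * j); rewrite -mulrA Dx.
    transitivity (- 3 * j%:~R * tau + (i%:~R - 3 * j%:~R) * (Y * tau)
      + j%:~R * ((Y ^+ 2 + 3 * Y + 3) * tau)); first by ring.
    by rewrite trY; ring.
move=> z; have [n An] := const_coef genK z; have [f [g Dz]] := span_cubes An.
have [i [j Df]] := Kc f; have [i' [j' Dg]] := Kc' g.
have [p [q Dk]] := Kc' ((Y + 3) * k).
exists (n + 3 * j), i, (i' + j * p), (j' + j * q).
transitivity (z - n%:~R + n%:~R); first by rewrite subrK.
rewrite Dz Df Dg; transitivity (i%:~R * sigma + j%:~R * (X * sigma
  - (Y + 3) * (k * tau)) + j%:~R * ((Y + 3) * k * tau)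
  + (i'%:~R * tau + j'%:~R * (Y * tau)) + n%:~R); first by ring.
by rewrite Dk -D3; ring.
Qed.

End Structure.

(** * The commutator subgroup as a quotient ring of Z[X, Y] *)

Local Close Scope ring_scope.
Local Open Scope group_scope.

Section GeneratedSubgroups.

Variable gT : finGroupType.

Lemma generated_ind (A : {set gT}) (P : gT -> Prop) :
  P 1 -> (forall z c, P z -> z \in <<A>> -> c \in A -> P (z * c)) ->
  forall z, z \in <<A>> -> P z.
Proof.
move=> P1 PM z /gen_prodgP[n [c Ac ->]].
elim: n c Ac => [|n IH] c Ac; first by rewrite big_ord0.
rewrite big_ord_recr /=; apply: PM => //; first exact: IH.
by apply: group_prod => i _; apply: mem_gen.
Qed.

(** Modulo the normal closure of [y, x], the generators commute. *)
Lemma pair_generates_der1 (G : {group gT}) (x y : gT) :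
  G :=: <<[set x; y]>> -> G^`(1) = <<[~ y, x] ^: G>>.
Proof.
move=> defG.
have [Gx Gy] : x \in G /\ y \in G.
  by rewrite defG !mem_gen ?inE ?eqxx ?orbT.
have sNG : <<[~ y, x] ^: G>> \subset G^`(1).
  rewrite gen_subG; apply/subsetP=> _ /imsetP[g Gg ->].
  by rewrite memJ_norm ?mem_commg //; apply: (subsetP (der_norm 1 G)).
have nNG : G \subset 'N(<<[~ y, x] ^: G>>) by apply/norms_gen/class_norm.
apply/eqP; rewrite eqEsubset sNG andbT; apply: der1_min => //=.
rewrite [X in X / _]defG quotient_gen -?defG; last first.
  by apply: subset_trans nNG; rewrite defG subset_gen.
rewrite abelian_gen.
have cxy : commute (coset <<[~ y, x] ^: G>> y) (coset <<[~ y, x] ^: G>> x).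
  have [nx ny] := (subsetP nNG x Gx, subsetP nNG y Gy).
  apply/commgP; rewrite -morphR //; apply/eqP/coset_id/mem_gen.
  exact: class_refl.
apply/centsP=> _ /morphimP[a _ + ->] _ /morphimP[b _ + ->].
by rewrite !inE => /orP[] /eqP-> /orP[] /eqP->.
Qed.

End GeneratedSubgroups.

Section CommutatorModule.

Variables (gT : finGroupType) (G : {group gT}) (abG' : abelian G^`(1)).
Local Notation M := (fmod_of abG').
Variables (x y : gT).
Hypothesis defG : G :=: <<[set x; y]>>.

Lemma pair_mem : x \in G /\ y \in G.
Proof. by rewrite defG !mem_gen ?inE ?eqxx ?orbT. Qed.

Lemma der1_normE g : g \in G -> g \in 'N(G^`(1)).
Proof. by apply/subsetP/der_norm. Qed.

Lemma act_sub1E g z : g \in G -> z \in G^`(1) ->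
  act_sub1 g (fmod abG' z) = fmod abG' [~ z, g].
Proof.
move=> Gg G'z; rewrite /act_sub1 -fmodJ ?der1_normE // commgEl.
by rewrite [RHS]fmodM ?groupV ?memJ_norm ?der1_normE // fmodV addrC.
Qed.

Lemma act_mpoly1 (u : M) : act_mpoly x y 1%R u = u.
Proof.
have -> : (1 = 1 *: 'X_[0%MM] :> {mpoly int[2]})%R by rewrite mpolyX0 scale1r.
by rewrite act_mpolyMX !mnm0E.
Qed.

Lemma act_mpolyX0 (u : M) : act_mpoly x y ('X_ord0)%R u = act_sub1 x u.
Proof. by rewrite -['X_ord0]scale1r act_mpolyMX !mnmE. Qed.

Lemma act_mpolyX1 (u : M) : act_mpoly x y ('X_ord_max)%R u = act_sub1 y u.
Proof. by rewrite -['X_ord_max]scale1r act_mpolyMX !mnmE. Qed.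

Lemma act_mpoly_surj (u : M) :
  exists f, act_mpoly x y f (fmod abG' [~ y, x]) == u.
Proof.
have [Gx Gy] := pair_mem; have Gs : [~ y, x] \in G^`(1) by rewrite mem_commg.
have sJ g : g \in G ->
    exists f, act_mpoly x y f (fmod abG' [~ y, x]) = fmod abG' ([~ y, x] ^ g).
  rewrite {1}defG; move: g; apply: generated_ind => [|g c [f Df] Gg].
    by exists 1%R; rewrite conjg1 act_mpoly1.
  rewrite -defG in Gg; rewrite !inE => /orP[]/eqP->.
    exists (f + 'X_ord0 * f)%R; rewrite act_mpolyD act_mpolyM // act_mpolyX0 Df.
    rewrite conjgM [in RHS]fmodJ ?der1_normE // /act_sub1.
    by rewrite addrC subrK.
  exists (f + 'X_ord_max * f)%R; rewrite act_mpolyD act_mpolyM // act_mpolyX1 Df.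
  rewrite conjgM [in RHS]fmodJ ?der1_normE // /act_sub1.
  by rewrite addrC subrK.
have : fmval u \in <<[~ y, x] ^: G>> by rewrite -pair_generates_der1 // fmodP.
suff gen z : z \in <<[~ y, x] ^: G>> ->
    exists f, act_mpoly x y f (fmod abG' [~ y, x]) = fmod abG' z.
  by case/gen => f Df; exists f; rewrite Df fmvalK.
move: z; apply: generated_ind => [|z c [f Df] Nz /imsetP[g Gg ->]].
  by exists 0%R; rewrite act_mpoly0 fmod1.
rewrite -pair_generates_der1 // in Nz.
have [h Dh] := sJ g Gg; exists (f + h)%R; rewrite act_mpolyD Df Dh.
by rewrite [RHS]fmodM ?memJ_norm ?der1_normE.
Qed.

(** The product of f s and g s is f g s.  It is well defined because Z[X, Y] is
commutative and s generates the module. *)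
Lemma commutator_ring : [~ y, x] != 1 ->
  exists (K : comNzRingType) (X Y : K) (phi : {additive M -> K}) (psi : K -> M),
  [/\ cancel phi psi, cancel psi phi & [/\ phi (fmod abG' [~ y, x]) = 1%R,
      forall u, phi (act_sub1 x u) = (X * phi u)%R,
      forall u, phi (act_sub1 y u) = (Y * phi u)%R & ring_generated X Y]].
Proof.
move=> nz_s; have [Gx Gy] := pair_mem; set s := fmod abG' _.
have Gs : [~ y, x] \in G^`(1) by rewrite mem_commg.
pose pre u := xchoose (act_mpoly_surj u).
have preK u : act_mpoly x y (pre u) s = u.
  by apply/eqP/(xchooseP (act_mpoly_surj u)).
pose mul u v : M := act_mpoly x y (pre u) v.
have mulE f v : mul (act_mpoly x y f s) v = act_mpoly x y f v.
  rewrite /mul -[v]preK -!act_mpolyM // mulrC [in RHS]mulrC !act_mpolyM //.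
  by rewrite preK.
have mulA : associative mul.
  move=> u v w; rewrite -[v]preK -[u]preK !mulE -(act_mpolyM Gx Gy _ _ s).
  by rewrite mulE act_mpolyM.
have mulC : commutative mul.
  by move=> u v; rewrite -[v]preK -[u]preK !mulE -!act_mpolyM // mulrC.
have mul1 : left_id s mul by move=> u; have := mulE 1%R u; rewrite !act_mpoly1.
have mulD : left_distributive mul +%R.
  move=> u v w; rewrite -[v]preK -[u]preK -act_mpolyD !mulE.
  by rewrite act_mpolyD.
have s_nz : s != 0%R.
  apply: contra nz_s => /eqP s0; rewrite -[X in X == _](fmodK abG') //.
  by rewrite -/s s0 fmval0.
pose K : comNzRingType := HB.pack_for comNzRingType M
  (GRing.Zmodule_isComNzRing.Build M mulA mulC mul1 mulD s_nz).
pose phi : {additive M -> K} := idfun : {additive M -> M}.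
exists K, (act_sub1 x s), (act_sub1 y s), phi, (id : K -> M).
have actX u : act_sub1 x u = mul (act_sub1 x s) u.
  by rewrite -[act_sub1 x s]act_mpolyX0 mulE act_mpolyX0.
have actY u : act_sub1 y u = mul (act_sub1 y s) u.
  by rewrite -[act_sub1 y s]act_mpolyX1 mulE act_mpolyX1.
split=> //; split=> // P P1 PB PX PY z.
have PX' u : P u -> P (act_sub1 x u) by rewrite actX; apply: PX.
have PY' u : P u -> P (act_sub1 y u) by rewrite actY; apply: PY.
have P0 : P 0%R by rewrite -(subrr (1%R : K)); apply: PB.
have PN u : P u -> P (- u)%R by rewrite -sub0r; apply: PB.
have PD u v : P u -> P v -> P (u + v)%R.
  by move=> Pu Pv; rewrite -[v]opprK; apply/PB/PN.
rewrite -[z]preK; elim/mpolyind: (pre z) => [|c m f _ _ Pf].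
  by rewrite act_mpoly0.
rewrite act_mpolyD; apply: (PD) => //; rewrite act_mpolyMX.
have {}P1 : P s by [].
have Pm : P (iter (m ord0) (act_sub1 x) (iter (m ord_max) (act_sub1 y) s)).
  elim: (m ord0) => [|k IH]; last exact: PX'.
  by elim: (m ord_max) => [|k IH]; last exact: PY'.
have PMn u k : P u -> P (u *+ k)%R.
  by move=> Pu; elim: k => // k IH; rewrite mulrS; apply: PD.
by case: c => k; [apply: PMn | apply/PN/PMn].
Qed.

End CommutatorModule.

(** * The lower central series and the cubes inside the ring *)

Section Translation.

Variables (gT : finGroupType) (G : {group gT}) (abG' : abelian G^`(1)).
Local Notation M := (fmod_of abG').
Variables (x y : gT).
Hypothesis defG : G :=: <<[set x; y]>>.
Variables (K : comNzRingType) (X Y : K) (phi : {additive M -> K}) (psi : K -> M).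
Hypothesis phiK : cancel phi psi.
Hypothesis psiK : cancel psi phi.
Hypothesis phi_s : phi (fmod abG' [~ y, x]) = 1%R.
Hypothesis phiX : forall u, phi (act_sub1 x u) = (X * phi u)%R.
Hypothesis phiY : forall u, phi (act_sub1 y u) = (Y * phi u)%R.
Hypothesis genK : ring_generated X Y.
Local Notation augpow := (augpow X Y).

Let Gx : x \in G := (pair_mem defG).1.
Let Gy : y \in G := (pair_mem defG).2.
Let nG' g : g \in G -> g \in 'N(G^`(1)) := @der1_normE _ G g.

Lemma phi_actX u : phi (u ^@ x)%R = ((1 + X) * phi u)%R.
Proof.
rewrite mulrDl mul1r -phiX -raddfD /act_sub1 /=; congr (phi _).
by rewrite addrC subrK.
Qed.

Lemma phi_actY u : phi (u ^@ y)%R = ((1 + Y) * phi u)%R.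
Proof.
rewrite mulrDl mul1r -phiY -raddfD /act_sub1 /=; congr (phi _).
by rewrite addrC subrK.
Qed.

Lemma phi_actXn n u : phi (u ^@ (x ^+ n))%R = ((1 + X) ^+ n * phi u)%R.
Proof.
elim: n u => [|n IH] u; first by rewrite actr1 mul1r.
by rewrite expgS actrM ?nG' ?groupX // IH phi_actX mulrA -exprSr.
Qed.

Lemma phi_actYn n u : phi (u ^@ (y ^+ n))%R = ((1 + Y) ^+ n * phi u)%R.
Proof.
elim: n u => [|n IH] u; first by rewrite actr1 mul1r.
by rewrite expgS actrM ?nG' ?groupX // IH phi_actY mulrA -exprSr.
Qed.

Lemma lcn_der1 j : 'L_j.+2(G) \subset G^`(1).
Proof. by rewrite -lcn2 lcn_sub_leq. Qed.

Lemma lcn_conj j z g : g \in G -> z \in 'L_j(G) -> z ^ g \in 'L_j(G).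
Proof. by move=> Gg Lz; rewrite memJ_norm // (subsetP (lcn_norm j G)). Qed.

Lemma fmval_act_sub1 g (u : M) : g \in G ->
  fmval (act_sub1 g u) = [~ fmval u, g].
Proof.
move=> Gg; rewrite -{1}[u]fmvalK act_sub1E ?fmodP // fmodK //.
by rewrite commgEl groupM ?groupV ?memJ_norm ?nG' ?fmodP.
Qed.

(** It suffices to consider the commutators [u, x] and [u, y], by the identity
[u, g c] = [u, g] [u^g, c]. *)
Lemma lcnS_ind j (P : M -> Prop) :
  (forall u v, P u -> P v -> P (u - v)%R) ->
  (forall u, fmval u \in 'L_j.+2(G) -> P (act_sub1 x u) /\ P (act_sub1 y u)) ->
  forall u, fmval u \in 'L_j.+3(G) -> P u.
Proof.
move=> PB Pxy.
have P0 : P 0%R.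
  rewrite -(subrr (act_sub1 x 0%R)).
  by have [Px _] := Pxy 0%R (group1 _); apply: (PB).
have PD u v : P u -> P v -> P (u + v)%R.
  by move=> Pu Pv; rewrite -[v]opprK; apply: (PB) => //; rewrite -sub0r; apply: PB.
have comm z g : g \in G -> z \in 'L_j.+2(G) -> P (fmod abG' [~ z, g]).
  move=> + Lz; rewrite {1}defG; move: g.
  apply: generated_ind => [|g c Pg Gg xyc]; first by rewrite commg1 fmod1.
  rewrite -defG in Gg; have G'z := subsetP (lcn_der1 j) z Lz.
  have Gc : c \in G by rewrite defG mem_gen.
  have G'c w g1 : w \in G^`(1) -> g1 \in G -> [~ w, g1] \in G^`(1).
    by move=> G'w Gg1; rewrite commgEl groupM ?groupV ?memJ_norm ?nG'.
  have G'zg : z ^ g \in G^`(1) by rewrite memJ_norm ?nG'.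
  have -> : [~ z, g * c] = [~ z, g] * [~ z ^ g, c].
    by rewrite !commgEl conjgM -[RHS]mulgA mulKVg.
  rewrite fmodM ?G'c //; apply: (PD) => //.
  rewrite -act_sub1E //; have [|Px Py] := Pxy (fmod abG' (z ^ g)).
    by rewrite fmodK // lcn_conj.
  by move: xyc; rewrite !inE => /orP[]/eqP->.
suff gen z : z \in 'L_j.+3(G) -> P (fmod abG' z).
  by move=> u /gen; rewrite fmvalK.
have L3 : 'L_j.+3(G) = <<commg_set 'L_j.+2(G) G>> by rewrite lcnSn.
rewrite {1}L3; move: z; apply: generated_ind; first by rewrite fmod1.
move=> z c Pz; rewrite -L3 => Lz /imset2P[a g La Gg Dc].
have Lc : c \in 'L_j.+3(G) by rewrite lcnSn Dc mem_commg.
have sL := subsetP (lcn_der1 j.+1).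
by rewrite fmodM ?sL //; apply: (PD) => //; rewrite Dc; apply: comm.
Qed.

Lemma lcn_augpow j u : fmval u \in 'L_j.+2(G) <-> augpow j (phi u).
Proof.
elim: j u => [|j IH] u; first by split=> // _; rewrite lcn2 fmodP.
have LM k (v w : M) : fmval v \in 'L_k(G) -> fmval w \in 'L_k(G) ->
    fmval (v + w)%R \in 'L_k(G).
  by move=> Lv Lw; rewrite fmvalA groupM.
split=> [|[g [h [Ag Ah Du]]]].
  move: u; apply: lcnS_ind => [u v Au Av|u Lu].
    by rewrite raddfB; apply: augpowB.
  rewrite phiX phiY; have Au := (IH u).1 Lu.
  by split; [apply: augpowX | apply: augpowY].
have -> : u = (act_sub1 x (psi g) + act_sub1 y (psi h))%R.
  by rewrite -[u]phiK -[RHS]phiK raddfD /= phiX phiY !psiK Du.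
apply: LM; rewrite fmval_act_sub1 // lcnSn mem_commg //.
  by apply/IH; rewrite psiK.
by apply/IH; rewrite psiK.
Qed.

Lemma lcn_index_cyclic j : augpow 1 3%R -> cyclic_factor X Y j ->
  #|'L_j.+2(G) : 'L_j.+3(G)| <= 3.
Proof.
move=> A3 [v Av cyc].
have nL : 'L_j.+2(G) \subset 'N('L_j.+3(G)).
  by apply: subset_trans (lcn_norm _ _); apply: lcn_sub.
have Lv : fmval (psi v) \in 'L_j.+2(G) by apply/lcn_augpow; rewrite psiK.
rewrite -card_quotient //; set t := coset 'L_j.+3(G) (fmval (psi v)).
apply: (@leq_trans #|<[t]>|); last first.
  apply: dvdn_leq => //; rewrite order_dvdn -morphX ?(subsetP nL) //.
  apply/eqP/coset_id; rewrite -fmvalZ; apply/lcn_augpow.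
  by rewrite raddfMn /= psiK -mulr_natl; apply: (augpow_mul A3).
apply/subset_leq_card/subsetP=> _ /morphimP[z Nz Lz ->].
have G'z := subsetP (lcn_der1 j) z Lz.
have [|i Ai] := cyc (phi (fmod abG' z)); first by apply/lcn_augpow; rewrite fmodK.
have Lzi : fmval (fmod abG' z - psi v *~ i)%R \in 'L_j.+3(G).
  by apply/lcn_augpow; rewrite raddfB raddfMz /= psiK -mulrzl.
rewrite fmvalA fmvalN fmodK // in Lzi.
have Lvi : fmval (psi v *~ i)%R \in 'L_j.+2(G).
  by apply/lcn_augpow; rewrite raddfMz /= psiK -mulrzl; apply: augpowM.
change (coset 'L_j.+3(G) z \in <[t]>).
rewrite -[z](mulgKV (fmval (psi v *~ i)%R)) morphM ?(subsetP nL) //; last first.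
  exact: (subsetP (lcn_subS _ _)).
rewrite /= coset_id // mul1g.
case: i {Ai Lzi Lvi} => i; rewrite ?NegzE ?mulrNz ?fmvalN -?pmulrn fmvalZ.
  by rewrite morphX ?(subsetP nL) // mem_cycle.
rewrite morphV ?groupX ?(subsetP nL) // morphX ?(subsetP nL) //.
by rewrite groupV mem_cycle.
Qed.

(** The trace identity [g^3, h] = [g, h]^(1 + g + g^2). *)
Lemma phi_cube g h : g \in G -> h \in G -> g ^+ 3 \in G^`(1) ->
  phi (act_sub1 h (fmod abG' (g ^+ 3))) =
  phi (fmod abG' [~ g, h] ^@ g ^@ g + fmod abG' [~ g, h] ^@ g
       + fmod abG' [~ g, h])%R.
Proof.
move=> Gg Gh G'g; rewrite act_sub1E //; congr (phi _).
have G'c : [~ g, h] \in G^`(1) by rewrite mem_commg.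
have -> : [~ g ^+ 3, h] = ([~ g, h] ^ g) ^ g * ([~ g, h] ^ g * [~ g, h]).
  by rewrite !expgS expg0 mulg1 !commMgJ conjgM.
have G'J w : w \in G^`(1) -> w ^ g \in G^`(1) by move=> ?; rewrite memJ_norm ?nG'.
rewrite (fmodM abG' (G'J _ (G'J _ G'c)) (groupM (G'J _ G'c) G'c)).
by rewrite (fmodM abG' (G'J _ G'c) G'c) !fmodJ ?nG' // addrA.
Qed.

Hypothesis cubeG : forall g, g \in G -> g ^+ 3 \in G^`(1).
Local Notation cube g := (phi (fmod abG' (g ^+ 3))).

Lemma act_sub1_cube g : g \in G -> act_sub1 g (fmod abG' (g ^+ 3)) = 0%R.
Proof.
move=> Gg; rewrite act_sub1E ?cubeG //; have -> : [~ g ^+ 3, g] = 1.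
  by apply/eqP/commgP/commute_sym/commuteX.
by rewrite fmod1.
Qed.

Lemma Y_cube_y : (Y * cube y = 0)%R.
Proof. by rewrite -phiY act_sub1_cube // raddf0. Qed.

Lemma X_cube_x : (X * cube x = 0)%R.
Proof. by rewrite -phiX act_sub1_cube // raddf0. Qed.

Lemma X_cube_y : (X * cube y = Y ^+ 2 + 3 * Y + 3)%R.
Proof.
rewrite -phiX phi_cube ?cubeG // !raddfD /= !phi_actY phi_s; ring.
Qed.

Lemma Y_cube_x : (Y * cube x = - (X ^+ 2 + 3 * X + 3))%R.
Proof.
rewrite -phiY phi_cube ?cubeG // !raddfD /= !phi_actX -invg_comm fmodV raddfN.
rewrite /= phi_s; ring.
Qed.

Let Z i : K := ((1 + Y) * (1 + X) ^+ i - 1)%R.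

Lemma phi_act_yxn i u : phi (u ^@ (y * x ^+ i))%R = ((1 + Z i) * phi u)%R.
Proof.
rewrite actrM ?nG' ?groupX // phi_actXn phi_actY /Z; ring.
Qed.

Lemma Z_cube_yxn i : (Z i * cube (y * x ^+ i)%g = 0)%R.
Proof.
have Gyx : y * x ^+ i \in G by rewrite groupM ?groupX.
have := congr1 phi (act_sub1_cube Gyx); rewrite raddf0 /act_sub1 raddfB /=.
rewrite phi_act_yxn => <-; ring.
Qed.

Lemma X_cube_yxn i :
  (X * cube (y * x ^+ i)%g = (Z i ^+ 2 + 3 * Z i + 3) * (1 + X) ^+ i)%R.
Proof.
have Gyx : y * x ^+ i \in G by rewrite groupM ?groupX.
rewrite -phiX phi_cube ?cubeG // !raddfD /= !phi_act_yxn.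
have -> : [~ y * x ^+ i, x] = [~ y, x] ^ (x ^+ i).
  rewrite commMgJ; have -> : [~ x ^+ i, x] = 1; last by rewrite mulg1.
  by apply/eqP/commgP/commute_sym/commuteX.
rewrite fmodJ ?nG' ?groupX // phi_actXn phi_s; ring.
Qed.

End Translation.

Section Generators.

Variables (gT : finGroupType) (G : {group gT}) (abG' : abelian G^`(1)).
Local Notation M := (fmod_of abG').
Hypothesis cubeG : forall g, g \in G -> g ^+ 3 \in G^`(1).
Hypothesis index3 : 3 < #|'L_3(G) : 'L_4(G)|.
Hypothesis index4 : 3 < #|'L_4(G) : 'L_5(G)|.

(** The cubes of x and y generate the factor of index 3 of the lower central
series. *)
Definition independent_cubes (x y : gT) : Prop :=
  forall u : M, fmval u \in 'L_3(G) -> exists a b : int,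
  fmval (u - (fmod abG' (y ^+ 3) *~ a + fmod abG' (x ^+ 3) *~ b))%R \in 'L_4(G).

Lemma generators_noncommuting x y : G :=: <<[set x; y]>> -> [~ y, x] != 1.
Proof.
move=> defG; apply/eqP=> c1; have G'1 : 'L_3(G) = 1.
  apply/trivgP; rewrite (subset_trans (lcn_der1 G 1)) //.
  by rewrite (pair_generates_der1 defG) c1 class1G genGid.
have := dvdn_indexg 'L_3(G) 'L_4(G); rewrite /= G'1 cards1 dvdn1 => /eqP i1.
by move: index3; rewrite G'1 i1.
Qed.

Lemma ex_independent_cubes_yxn x y : G :=: <<[set x; y]>> ->
  x ^+ 3 \notin 'L_4(G) -> exists i, independent_cubes x (y * x ^+ i).
Proof.
move=> defG Lx; have s_nz := generators_noncommuting defG.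
have [K [X [Y [phi [psi [phiK psiK [phi_s phiX phiY genK]]]]]]] :=
  commutator_ring abG' defG s_nz.
have A3 := augpow1_three (X_cube_y defG phi_s phiX phiY cubeG).
have cyc j := lcn_index_cyclic defG phiK psiK phiX phiY (j := j) A3.
have lcnP := lcn_augpow defG phiK psiK phiX phiY.
have [|||i spans] := @ex_independent_cubes K X Y (phi (fmod abG' (x ^+ 3)))
    genK A3 _ _ (X_cube_x defG phiX cubeG) _
    (fun i => phi (fmod abG' ((y * x ^+ i) ^+ 3)))
    (fun i => Z_cube_yxn defG phiX phiY cubeG i)
    (fun i => X_cube_yxn defG phi_s phiX phiY cubeG i).
- by move/cyc; rewrite leqNgt index3.
- by move/cyc; rewrite leqNgt index4.
- move/(lcnP 2); rewrite (fmodK abG' (cubeG (pair_mem defG).1)).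
  exact: (negP Lx).
exists i => u /(lcnP 1%N)/spans[a [b /=]].
rewrite !mulrzl -!raddfMz -raddfD -raddfB => /(lcnP 2) Lab.
by exists a, b.
Qed.

Lemma ex_shallow_cube x y : G :=: <<[set x; y]>> ->
  [|| x ^+ 3 \notin 'L_4(G), y ^+ 3 \notin 'L_4(G) | (y * x) ^+ 3 \notin 'L_4(G)].
Proof.
move=> defG; have s_nz := generators_noncommuting defG.
have [K [X [Y [phi [psi [phiK psiK [phi_s phiX phiY genK]]]]]]] :=
  commutator_ring abG' defG s_nz.
have A3 := augpow1_three (X_cube_y defG phi_s phiX phiY cubeG).
have lcnP := lcn_augpow defG phiK psiK phiX phiY.
have [Gx Gy] := pair_mem defG.
rewrite -!negb_and; apply/and3P=> -[Lx Ly Lyx].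
have := lcn_index_cyclic defG phiK psiK phiX phiY (j := 2) A3.
rewrite leqNgt index4 => ncyc; suff /ncyc : cyclic_factor X Y 2 by [].
apply: (deep_cubes_cyclic (sigma := phi (fmod abG' (y ^+ 3)))
  (tau := phi (fmod abG' (x ^+ 3))) (rho := phi (fmod abG' ((y * x) ^+ 3)))) => //.
- exact: (X_cube_y defG phi_s phiX phiY cubeG).
- exact: (Y_cube_x defG phi_s phiX phiY cubeG).
- exact: (X_cube_yxn defG phi_s phiX phiY cubeG 1%N).
- by apply/(lcnP 2); rewrite (fmodK abG' (cubeG Gy)).
- by apply/(lcnP 2); rewrite (fmodK abG' (cubeG Gx)).
- by apply/(lcnP 2); rewrite (fmodK abG' (cubeG (groupM Gy Gx))).
Qed.

Lemma generators_yxn x y i : G :=: <<[set x; y]>> ->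
  G :=: <<[set x; y * x ^+ i]>>.
Proof.
move=> defG; have [Gx Gy] := pair_mem defG.
apply/eqP; rewrite eqEsubset {1}defG !gen_subG !subUset !sub1set Gx groupM ?groupX //.
have Hx : x \in <<[set x; y * x ^+ i]>> by rewrite mem_gen ?inE ?eqxx.
rewrite Hx andbT /= -(groupMr _ (groupX i Hx)).
by rewrite mem_gen // !inE eqxx orbT.
Qed.

Lemma generatorsC x y : G :=: <<[set x; y]>> -> G :=: <<[set y; x]>>.
Proof. by rewrite setUC. Qed.

Lemma ex_independent_generators x y : G :=: <<[set x; y]>> ->
  exists x' y', G :=: <<[set x'; y']>> /\ independent_cubes x' y'.
Proof.
move=> defG; have good a b : G :=: <<[set a; b]>> -> a ^+ 3 \notin 'L_4(G) ->
    exists x' y', G :=: <<[set x'; y']>> /\ independent_cubes x' y'.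
  move=> defGab La; have [i ind] := ex_independent_cubes_yxn defGab La.
  by exists a, (b * a ^+ i); split=> //; apply: generators_yxn.
have [||] := or3P (ex_shallow_cube defG); first exact: (good _ _ defG).
  exact: (good _ _ (generatorsC defG)).
have := generatorsC (generators_yxn 1%N defG); rewrite expg1; exact: good.
Qed.

End Generators.

(** * Consequences of the vanishing defect *)

Section Defect.

Variables (gT : finGroupType) (G : {group gT}) (abG' : abelian G^`(1)).
Local Notation M := (fmod_of abG').
Hypothesis cubeG : forall g, g \in G -> g ^+ 3 \in G^`(1).
Hypothesis index3 : 3 < #|'L_3(G) : 'L_4(G)|.
Variables (x y : gT).
Hypothesis defG : G :=: <<[set x; y]>>.
Let Gx : x \in G := (pair_mem defG).1.
Let Gy : y \in G := (pair_mem defG).2.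

Lemma pair_decomposition g : g \in G ->
  exists i j c, [/\ i < 3, j < 3, c \in G^`(1) & g = x ^+ i * y ^+ j * c].
Proof.
move=> Gg; have nG' : G \subset 'N(G^`(1)) := der_norm 1 G.
have nG'g h : h \in G -> h \in 'N(G^`(1)) := subsetP nG' h.
have cxy : commute (coset G^`(1) x) (coset G^`(1) y).
  by apply: (centsP (der_abelian 0 G)); rewrite mem_quotient.
have [i [j Dg]] : exists i j,
    coset G^`(1) g = coset G^`(1) x ^+ i * coset G^`(1) y ^+ j.
  move: Gg; rewrite {1}defG; move: g.
  apply: generated_ind => [|g c [i [j Dg]]]; first by exists 0%N, 0%N; rewrite morph1 mulg1.
  rewrite -defG => Gg; rewrite !inE => /orP[]/eqP->.
    exists i.+1, j; rewrite morphM ?nG'g //= Dg expgSr -!mulgA; congr (_ * _).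
    exact/commute_sym/commuteX.
  by exists i, j.+1; rewrite morphM ?nG'g //= Dg expgSr mulgA.
have red h k : h \in G -> coset G^`(1) h ^+ k = coset G^`(1) (h ^+ (k %% 3)).
  move=> Gh; rewrite morphX ?nG'g // expg_mod //.
  by rewrite -morphX ?nG'g //; apply/coset_id/cubeG.
rewrite !red // -morphM ?nG'g ?groupX //= in Dg.
set w := x ^+ _ * y ^+ _ in Dg; have Gw : w \in G by rewrite groupM ?groupX.
exists (i %% 3), (j %% 3), (w^-1 * g); rewrite !ltn_mod; split=> //; last first.
  by rewrite mulKVg.
apply: coset_idr; first by rewrite groupM ?groupV ?nG'g.
by rewrite morphM ?groupV ?nG'g //= morphV ?nG'g //= Dg mulVg.
Qed.

(** For i = 1, 2 the quotient of (1 + X)^i - 1 by X is invertible modulo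
X^2 + 3 X + 3. *)
Lemma X_killed (K : comNzRingType) (X v : K) i : i < 3 -> i != 0%N ->
  (X * (X ^+ 2 + 3 * X + 3) = 0 -> ((1 + X) ^+ i - 1) * v = 0 -> X * v = 0)%R.
Proof.
case: i => [|[|[|i]]] // _ _ trX; first by move=> <-; ring.
move=> Xv; transitivity (X * (X ^+ 2 + 3 * X + 3) * v
  - (1 + X) * (((1 + X) ^+ 2 - 1) * v))%R; first by ring.
by rewrite trX Xv !mul0r mulr0 subrr.
Qed.

(** Modulo G', the element g is x^i y^j, and i or j is prime to 3.  It fixes the
images of sigma under powers of X, on which y acts trivially, and those of tau
under powers of Y, on which x acts trivially. *)
Lemma defect_kills g e : 3 <= e -> g \in G -> g \notin G^`(1) ->
  (forall z, z \in 'L_e(G) -> [~ z, g] = 1) ->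
  iter (e - 2) (act_sub1 x) (fmod abG' (y ^+ 3)) = 0%R \/
  iter (e - 2) (act_sub1 y) (fmod abG' (x ^+ 3)) = 0%R.
Proof.
move=> le3e Gg G'g cent_g; have s_nz := generators_noncommuting index3 defG.
have [K [X [Y [phi [psi [phiK psiK [phi_s phiX phiY genK]]]]]]] :=
  commutator_ring abG' defG s_nz.
have Ysig := Y_cube_y defG phiY cubeG; have Xtau := X_cube_x defG phiX cubeG.
have Xsig := X_cube_y defG phi_s phiX phiY cubeG.
have Ytau := Y_cube_x defG phi_s phiX phiY cubeG.
have A3 := augpow1_three Xsig.
have lcnP := lcn_augpow defG phiK psiK phiX phiY.
have ncyc1 : ~ cyclic_factor X Y 1.
  have := lcn_index_cyclic defG phiK psiK phiX phiY (j := 1%N) A3.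
  by rewrite leqNgt index3 => cyc /cyc.
have [As At] := cubes_augpow1 genK Ysig Xtau Xsig ncyc1.
have iterX n u : phi (iter n (act_sub1 x) u) = (X ^+ n * phi u)%R.
  by elim: n => [|n IH]; rewrite ?mul1r //= phiX IH mulrA exprS.
have iterY n u : phi (iter n (act_sub1 y) u) = (Y ^+ n * phi u)%R.
  by elim: n => [|n IH]; rewrite ?mul1r //= phiY IH mulrA exprS.
have [i [j [c [lti ltj G'c Dg]]]] := pair_decomposition Gg.
have nG' h : h \in G -> h \in 'N(G^`(1)) by apply/subsetP/der_norm.
have Gc : c \in G := subsetP (der_sub 1 G) c G'c.
have kill v : augpow X Y (e - 2) v -> ((1 + X) ^+ i * (1 + Y) ^+ j * v = v)%R.
  move=> Av; have Lv : fmval (psi v) \in 'L_e(G).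
    have -> : e = (e - 2).+2 by lia.
    by apply/lcnP; rewrite psiK.
  have /eqP := fmval_act_sub1 (psi v) Gg; rewrite cent_g // => /eqP gv.
  have {}gv : act_sub1 g (psi v) = 0%R by apply: val_inj; rewrite fmval0.
  have := congr1 phi gv; rewrite raddf0 /act_sub1 raddfB /= psiK => /eqP.
  rewrite subr_eq0 => /eqP Dv.
  rewrite -[RHS]Dv Dg !actrM ?groupM ?nG' ?groupX //.
  have -> u : (u ^@ c)%R = u :> M.
    apply: val_inj; rewrite fmvalJ ?nG' //; apply/conjg_fixP/commgP.
    by apply: (centsP abG'); rewrite ?fmodP.
  by rewrite (phi_actYn defG phiY) (phi_actXn defG phiX) psiK; ring.
have [i0|nz_i] := eqVneq i 0%N; last first.
  left; apply: (can_inj phiK); rewrite raddf0 iterX.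
  have -> : e - 2 = (e - 3).+1 by lia.
  rewrite exprS -mulrA; apply: (X_killed lti nz_i (X_trace0 Xtau Ytau)).
  rewrite mulrBl mul1r; apply/eqP; rewrite subr_eq0; apply/eqP.
  have Ysig' k : ((1 + Y) ^+ k * (X ^+ (e - 3) * phi (fmod abG' (y ^+ 3))) =
      X ^+ (e - 3) * phi (fmod abG' (y ^+ 3)))%R.
    elim: k => [|k IH]; first by rewrite mul1r.
    by rewrite exprSr -mulrA mulrDl mul1r mulrCA Ysig mulr0 addr0.
  have := kill (X ^+ (e - 3) * phi (fmod abG' (y ^+ 3)))%R.
  rewrite -mulrA Ysig'; apply; have -> : e - 2 = (e - 3) + 1 by lia.
  by apply: augpow_mul => //; apply/augpow_exp/augpow_X1.
have [j0|nz_j] := eqVneq j 0%N.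
  by case/negP: G'g; rewrite Dg i0 j0 !mul1g.
right; apply: (can_inj phiK); rewrite raddf0 iterY.
have -> : e - 2 = (e - 3).+1 by lia.
rewrite exprS -mulrA; apply: (X_killed ltj nz_j (Y_trace0 Ysig Xsig)).
rewrite mulrBl mul1r; apply/eqP; rewrite subr_eq0; apply/eqP.
have := kill (Y ^+ (e - 3) * phi (fmod abG' (x ^+ 3)))%R.
rewrite i0 mul1r; apply; have -> : e - 2 = (e - 3) + 1 by lia.
by apply: augpow_mul => //; apply/augpow_exp/augpow_Y1.
Qed.

(** Generators with the orders of the standard basis of
A(3, m - 2) + A(3, e - 2), at this stage only up to divisibility. *)
Definition nearly_homocyclic_basis (m e : nat) := exists a1 a2 a3 a4 : M,
  [/\ (a1 *+ 3 ^ uphalf (m - 2) = 0)%R, (a2 *+ 3 ^ (m - 2)./2 = 0)%R,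
      (a3 *+ 3 ^ uphalf (e - 2) = 0)%R, (a4 *+ 3 ^ (e - 2)./2 = 0)%R
    & forall u, exists i j k l : int,
        (u = a1 *~ i + a2 *~ j + a3 *~ k + a4 *~ l)%R].

Lemma ex_nearly_homocyclic_basis m e : independent_cubes abG' x y ->
  4 <= m -> e < m -> 'L_m(G) = 1 ->
  iter (e - 2) (act_sub1 y) (fmod abG' (x ^+ 3)) = 0%R ->
  nearly_homocyclic_basis m e.
Proof.
move=> ind le4m lt_em Lm Ybt; have s_nz := generators_noncommuting index3 defG.
have [K [X [Y [phi [psi [phiK psiK [phi_s phiX phiY genK]]]]]]] :=
  commutator_ring abG' defG s_nz.
have Ysig := Y_cube_y defG phiY cubeG; have Xtau := X_cube_x defG phiX cubeG.
have Xsig := X_cube_y defG phi_s phiX phiY cubeG.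
have Ytau := Y_cube_x defG phi_s phiX phiY cubeG.
have A3 := augpow1_three Xsig.
have lcnP := lcn_augpow defG phiK psiK phiX phiY.
have ncyc1 : ~ cyclic_factor X Y 1.
  have := lcn_index_cyclic defG phiK psiK phiX phiY (j := 1%N) A3.
  by rewrite leqNgt index3 => cyc /cyc.
have [As At] := cubes_augpow1 genK Ysig Xtau Xsig ncyc1.
have iterY n u : phi (iter n (act_sub1 y) u) = (Y ^+ n * phi u)%R.
  by elim: n => [|n IH]; rewrite ?mul1r //= phiY IH mulrA exprS.
have nilK z : augpow X Y (m - 2) z -> z = 0%R.
  rewrite -{1}[z]psiK => /lcnP; have -> : (m - 2).+2 = m by lia.
  rewrite Lm => /set1P z1; rewrite -[z]psiK; have -> : psi z = 0%R.
    by apply: val_inj; rewrite /= z1.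
  by rewrite raddf0.
have spans : spans_factor1 X Y (phi (fmod abG' (y ^+ 3))) (phi (fmod abG' (x ^+ 3))).
  move=> z; rewrite -{1}[z]psiK => /(lcnP 1%N)/ind[a [b Lab]]; exists a, b.
  by move/(lcnP 2): Lab; rewrite raddfB raddfD !raddfMz /= psiK !mulrzl.
have Xas : (X ^+ (m - 3) * phi (fmod abG' (y ^+ 3)) = 0)%R.
  apply: nilK; have -> : m - 2 = (m - 3) + 1 by lia.
  by apply: augpow_mul => //; apply/augpow_exp/augpow_X1.
have Ybt' : (Y ^+ (e - 2) * phi (fmod abG' (x ^+ 3)) = 0)%R.
  by rewrite -iterY Ybt raddf0.
have leba : e - 2 <= m - 3 by lia.
have [] := additive_generators genK Ysig Xtau Xsig Ytau ncyc1 spans nilK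
  Xas Ybt' leba.
have -> : (m - 3).+1 = m - 2 by lia.
move=> k1 k2 k3 k4 gen.
have tors n u : (3 ^+ n * phi u = 0)%R -> (u *+ 3 ^ n = 0)%R.
  move=> n0; apply: (can_inj phiK); rewrite raddf0 raddfMn /=.
  by rewrite -mulr_natl natrX n0.
exists (fmod abG' [~ y, x]), (fmod abG' (y ^+ 3)), (fmod abG' (x ^+ 3)),
  (act_sub1 y (fmod abG' (x ^+ 3))).
split; try apply: tors; rewrite ?phi_s ?mulr1 ?phiY //.
move=> u; have [i [j [k [l Du]]]] := gen (phi u); exists i, j, k, l.
apply: (can_inj phiK); rewrite Du !raddfD !raddfMz /= phi_s phiY.
by rewrite !mulrzl.
Qed.

End Defect.

(** * Additive isomorphisms *)

Section AdditiveIsomorphisms.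

Lemma isomorphic_add_sym (U V : zmodType) : isomorphic_add U V -> isomorphic_add V U.
Proof.
case=> f [g fK gK].
pose G : {additive V -> U} := HB.pack_for {additive V -> U} g
  (GRing.isZmodMorphism.Build V U g (can2_zmod_morphism fK gK)).
by exists G, f.
Qed.

Lemma isomorphic_add_trans (U V W : zmodType) :
  isomorphic_add U V -> isomorphic_add V W -> isomorphic_add U W.
Proof. by case=> f bij_f [g bij_g]; exists (g \o f); apply: bij_comp. Qed.

Lemma Zp_additive (V : zmodType) (n : nat) (a : V) : 1 < n ->
  (a *+ n = 0)%R -> exists f : {additive 'Z_n -> V}, f 1%R = a.
Proof.
move=> n_gt1 an0; pose f (z : 'Z_n) := (a *+ z)%R.
have fD z w : (f (z + w) = f z + f w)%R.
  rewrite /f -mulrnDr [in RHS](divn_eq (z + w) n) mulrnDr mulnC mulrnA an0 mul0rn.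
  by rewrite add0r /= [X in _ %% X]Zp_cast.
have fB : GRing.zmod_morphism f.
  by move=> z w; apply/eqP; rewrite eq_sym subr_eq -fD subrK.
exists (HB.pack_for {additive 'Z_n -> V} f (GRing.isZmodMorphism.Build _ _ f fB)).
by rewrite /= /f /= [X in _ %% X]Zp_cast // modn_small ?mulr1n.
Qed.

(** The generators define a surjection from the product of cyclic groups, and the
bound on the order of V makes it bijective. *)
Lemma Zp_prod_isomorphic_add (V : finZmodType) (n1 n2 n3 n4 : nat) (a1 a2 a3 a4 : V) :
  1 < n1 -> 1 < n2 -> 1 < n3 -> 1 < n4 ->
  (a1 *+ n1 = 0)%R -> (a2 *+ n2 = 0)%R -> (a3 *+ n3 = 0)%R -> (a4 *+ n4 = 0)%R ->
  (forall u, exists i j k l : int,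
     (u = a1 *~ i + a2 *~ j + a3 *~ k + a4 *~ l)%R) ->
  n1 * n2 * (n3 * n4) <= #|V| ->
  isomorphic_add V (('Z_n1 * 'Z_n2) * ('Z_n3 * 'Z_n4))%type.
Proof.
move=> gt1 gt2 gt3 gt4 a1n a2n a3n a4n gen leV.
have [f1 Df1] := Zp_additive gt1 a1n; have [f2 Df2] := Zp_additive gt2 a2n.
have [f3 Df3] := Zp_additive gt3 a3n; have [f4 Df4] := Zp_additive gt4 a4n.
pose f (p : ('Z_n1 * 'Z_n2) * ('Z_n3 * 'Z_n4)) : V :=
  (f1 p.1.1 + f2 p.1.2 + f3 p.2.1 + f4 p.2.2)%R.
have fB : GRing.zmod_morphism f.
  move=> p q; rewrite /f !raddfB /= !opprD.
  rewrite [RHS]addrACA; congr (_ + _)%R; rewrite [RHS]addrACA; congr (_ + _)%R.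
  by rewrite [RHS]addrACA.
pose F : {additive ('Z_n1 * 'Z_n2) * ('Z_n3 * 'Z_n4) -> V} :=
  HB.pack_for {additive _ -> V} f (GRing.isZmodMorphism.Build _ _ f fB).
have F_surj u : exists p, F p == u.
  have [i [j [k [l ->]]]] := gen u.
  exists ((i%:~R, j%:~R), (k%:~R, l%:~R))%R.
  by rewrite /= /f /= !raddfMz /= Df1 Df2 Df3 Df4.
pose g u := xchoose (F_surj u).
have gK : cancel g F by move=> u; apply/eqP/(xchooseP (F_surj u)).
have leN : #|{: ('Z_n1 * 'Z_n2) * ('Z_n3 * 'Z_n4)}| <= #|V|.
  by rewrite !card_prod !card_ord !Zp_cast.
have [h gK' hK] := inj_card_bij (can_inj gK) leN.
apply: isomorphic_add_sym; exists F, g => // p.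
by rewrite -[p]hK gK.
Qed.

Lemma card_Zp_torsion n k : n = (3 ^ k.+1)%N ->
  #|[pred z : 'Z_n | (z *+ 3 == 0)%R]| = 3.
Proof.
move=> Dn; have n_gt1 : 1 < n by rewrite Dn (leq_ltn_trans _ (ltn_expl k.+1 _)).
have p_gt0 : 0 < (3 ^ k)%N by rewrite expn_gt0.
pose f (c : 'I_3) : 'Z_n := inZp (c * 3 ^ k)%N.
have fE c : f c = (c * 3 ^ k)%N :> nat.
  by rewrite /= [X in _ %% X]Zp_cast // modn_small // Dn expnS ltn_pmul2r.
have f_inj : injective f.
  move=> c d /(congr1 (@nat_of_ord _)); rewrite !fE => /eqP.
  by rewrite eqn_pmul2r // => /eqP/val_inj.
rewrite -[RHS]card_ord -(card_image f_inj); apply: eq_card => z.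
have z3 : ((z *+ 3)%R == 0%R) = (3 ^ k.+1 %| z * 3)%N.
  by rewrite Zp_mulrn -(inj_eq val_inj) /= [X in _ %% X]Zp_cast // -Dn.
rewrite inE z3 expnSr dvdn_pmul2r //; apply/idP/imageP => [/dvdnP[c Dz]|[c _ ->]].
  have ltc : c < 3.
    by have := ltn_ord z; rewrite Dz [X in _ < X]Zp_cast // Dn expnS ltn_pmul2r.
  by exists (Ordinal ltc) => //; apply: ord_inj; rewrite fE.
by rewrite fE dvdn_mull.
Qed.

End AdditiveIsomorphisms.

Section AnnihilatorQuotient.

Variables (gT : finGroupType) (G : {group gT}) (abG' : abelian G^`(1)).
Local Notation M := (fmod_of abG').

(** Evaluation at s is onto, and its kernel is the annihilator. *)
Lemma der1_isomorphic_quotient x y : G :=: <<[set x; y]>> ->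
  isomorphic_add M {ideal_quot annihilator abG' x y}.
Proof.
move=> defG; set s := fmod abG' [~ y, x].
pose Q := {ideal_quot annihilator abG' x y}.
pose pre (u : M) := xchoose (act_mpoly_surj defG u).
have preK u : act_mpoly x y (pre u) s = u.
  by apply/eqP/(xchooseP (act_mpoly_surj defG u)).
have piE (f g : {mpoly int[2]}) :
    (\pi_Q f == \pi_Q g)%qT = (act_mpoly x y f s == act_mpoly x y g s).
  by rewrite -Quotient.idealrBE inE act_mpolyB subr_eq0.
pose h (u : M) : Q := \pi_Q%qT (pre u).
have hB : GRing.zmod_morphism h.
  move=> u v; rewrite /h -raddfB /=; apply/eqP.
  by rewrite piE act_mpolyB !preK.
exists (HB.pack_for {additive M -> Q} h (GRing.isZmodMorphism.Build _ _ h hB)).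
exists (fun q : Q => act_mpoly x y (generic_quotient.repr q) s) => [u|q] /=.
  by rewrite -[RHS]preK; apply/eqP; rewrite -piE reprK.
by rewrite -[RHS]reprK; apply/eqP; rewrite piE preK.
Qed.

End AnnihilatorQuotient.

(** * Orders, and the theorem *)

Section ThreeGroups.

Variables (gT : finGroupType) (G : {group gT}).
Hypothesis pG : 3.-group G.

(** Generators of the abelianization lift because G' lies in the Frattini
subgroup. *)
Lemma abelian_type33 : abelian_type (G / G^`(1)) = [:: 3; 3] ->
  (forall g, g \in G -> g ^+ 3 \in G^`(1)) /\
  exists x y, G :=: <<[set x; y]>>.
Proof.
move=> typeG; have nG' : G \subset 'N(G^`(1)) := der_norm 1 G.
have abQ : abelian (G / G^`(1)) := der_abelian 0 G.
have [b defQ ordb] := abelian_structure abQ; rewrite typeG in ordb.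
case: b => [|a [|c [|]]] // in defQ ordb; case: ordb => oa oc.
rewrite !big_cons big_nil dprodg1 in defQ.
have defM := dprodW defQ; have [sa sc] := mulG_sub defM.
have Qa : a \in G / G^`(1) by rewrite (subsetP sa) ?cycle_id.
have Qc : c \in G / G^`(1) by rewrite (subsetP sc) ?cycle_id.
split=> [g Gg|].
  have Ng := subsetP nG' g Gg; apply: coset_idr; first by rewrite groupX.
  rewrite morphX //=; have := mem_quotient G^`(1) Gg; rewrite -defM.
  case/mulsgP=> _ _ /cycleP[i ->] /cycleP[j ->] ->.
  rewrite expgMn; last by apply/commuteX2/(centsP abQ).
  by rewrite -!expgM mulnC [(j * 3)%N]mulnC !expgM -{1}oa -{1}oc !expg_order
     !expg1n mulg1.
have [x Nx Gx Da] := morphimP Qa; have [y Ny Gy Dc] := morphimP Qc.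
exists x, y; apply/esym/Phi_nongen/eqP; rewrite eqEsubset join_subG Phi_sub /=.
apply/andP; split; first by rewrite subUset !sub1set Gx Gy.
have sG'Phi : G^`(1) \subset 'Phi(G).
  by rewrite (Phi_joing pG) joing_subl.
apply: subset_trans (genS (setSU _ sG'Phi)).
have sxyG : [set x; y] \subset G by rewrite subUset !sub1set Gx Gy.
rewrite -(quotientSGK nG') ?joing_subl //.
rewrite -defM Da Dc mul_subG // cycle_subG /= mem_quotient // mem_gen //.
  by rewrite !inE eqxx !orbT.
by rewrite !inE eqxx !orbT.
Qed.

(** The factor of index 2 and those of index above e have order at least 3, the
ones of index 3 to e have order at least 9. *)
Lemma card_der1_lower_bound (m e : nat) : m = nilpotency_index G -> e < m -> 3 <= e ->
  G^`(1) != 1 ->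
  (forall j, 3 <= j <= e -> 3 < #|'L_j(G) : 'L_j.+1(G)|) ->
  (3 ^ (m - 2 + (e - 2)) <= #|G^`(1)|)%N.
Proof.
move=> Dm lt_em le3e G'1 big_index.
have nilG := pgroup_nil pG.
have idx j k : (3 ^ k < #|'L_j(G) : 'L_j.+1(G)|)%N ->
    (3 ^ k.+1 <= #|'L_j(G) : 'L_j.+1(G)|)%N.
  have /p_natP[i ->] : 3.-nat #|'L_j(G) : 'L_j.+1(G)|.
    by apply: pnat_dvd (dvdn_indexg _ _) (pgroupS (lcn_sub _ _) pG).
  by rewrite ltn_exp2l // leq_exp2l.
have lag j : (#|'L_j.+1(G)| * #|'L_j(G) : 'L_j.+1(G)| = #|'L_j(G)|)%N.
  exact/Lagrange/lcn_subS.
have idx1 j : 0 < j < m -> 1 < #|'L_j(G) : 'L_j.+1(G)|.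
  case: j => // j /andP[_ ltjm]; rewrite indexg_gt1 /= lcnSn.
  have Lj1 : 'L_j.+1(G) != 1.
    apply/negP=> /eqP/(lcn_nil_classP _ nilG).
    by rewrite Dm /nilpotency_index in ltjm; lia.
  apply/proper_subn/(nil_comm_properl nilG (lcn_sub _ _) Lj1).
  by rewrite subsetI subxx lcn_norm.
have top i : i <= m - 2 -> (3 ^ i <= #|'L_(m - i)(G)|)%N.
  elim: i => [|i IH] lei; first by rewrite cardG_gt0.
  have Dmi : (m - i.+1).+1 = m - i by lia.
  rewrite -lag Dmi expnSr leq_mul //; first by apply: IH; lia.
  by rewrite -Dmi (idx _ 0%N) // idx1 //; lia.
have mid i : i <= e - 2 -> (3 ^ (m - e.+1 + i.*2) <= #|'L_(e.+1 - i)(G)|)%N.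
  elim: i => [|i IH] lei.
    rewrite double0 addn0 subn0; have := top (m - e.+1).
    have -> : m - (m - e.+1) = e.+1 by lia.
    by apply; lia.
  have Dei : (e.+1 - i.+1).+1 = e.+1 - i by lia.
  have -> : m - e.+1 + i.+1.*2 = (m - e.+1 + i.*2) + 2 by lia.
  rewrite -lag Dei expnD leq_mul //; first by apply: IH; lia.
  by rewrite -Dei (idx _ 1%N) // big_index //; lia.
rewrite -lcn2 -lag.
have -> : (m - 2 + (e - 2) = (m - e.+1 + (e - 2).*2) + 1)%N by lia.
rewrite expnD leq_mul //; last by rewrite (idx _ 0%N) // idx1 //; lia.
by have := mid _ (leqnn _); rewrite (_ : e.+1 - (e - 2) = 3) //; lia.
Qed.

End ThreeGroups.

Section ModuleCardinals.

Variables (gT : finGroupType) (A : {group gT}) (abA : abelian A).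

Lemma card_fmod : #|{: fmod_of abA}| = #|A|.
Proof. by rewrite card_sub; apply: eq_card => z; rewrite inE. Qed.

Lemma card_fmod_torsion k : #|'Ldiv_k(A)| = #|[pred u : fmod_of abA | u *+ k == 0]%R|.
Proof.
rewrite -(card_imset _ (@fmod_inj _ _ abA)); apply: eq_card => z.
apply/LdivP/imsetP=> [[Az zk]|[u]].
  exists (fmod abA z); last by rewrite fmodK.
  by rewrite inE -fmodX // zk fmod1.
rewrite inE => /eqP uk ->; split; first exact: fmodP.
by rewrite -fmvalZ uk fmval0.
Qed.

End ModuleCardinals.

Lemma pair_torsion (U V : zmodType) (p : U * V) k :
  ((p *+ k == 0) = (p.1 *+ k == 0) && (p.2 *+ k == 0))%R.
Proof.
have -> : (p *+ k = (p.1 *+ k, p.2 *+ k))%R.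
  by elim: k => // k IH; rewrite !mulrS IH.
exact: xpair_eqE.
Qed.

Lemma card_Zp_prod_torsion (n1 n2 n3 n4 k1 k2 k3 k4 : nat) :
  n1 = (3 ^ k1.+1)%N -> n2 = (3 ^ k2.+1)%N ->
  n3 = (3 ^ k3.+1)%N -> n4 = (3 ^ k4.+1)%N ->
  #|[pred p : ('Z_n1 * 'Z_n2) * ('Z_n3 * 'Z_n4) | p *+ 3 == 0]%R| = (3 ^ 4)%N.
Proof.
move=> D1 D2 D3 D4.
pose T n := [pred z : 'Z_n | z *+ 3 == 0]%R.
have -> : (3 ^ 4 = #|predX (predX (T n1) (T n2)) (predX (T n3) (T n4))|)%N.
  have cT n k : n = (3 ^ k.+1)%N -> #|T n| = 3 by apply: card_Zp_torsion.
  have c2 n k n' k' : n = (3 ^ k.+1)%N -> n' = (3 ^ k'.+1)%N ->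
      #|predX (T n) (T n')| = 9.
    move=> Dn Dn'; transitivity (#|T n| * #|T n'|)%N; first exact: cardX.
    by rewrite (cT _ _ Dn) (cT _ _ Dn').
  transitivity (#|predX (T n1) (T n2)| * #|predX (T n3) (T n4)|)%N.
    by rewrite (c2 _ _ _ _ D1 D2) (c2 _ _ _ _ D3 D4).
  by apply/esym/cardX.
by apply: eq_card => p; rewrite !inE !pair_torsion.
Qed.

Lemma exp3_gt1 k : 0 < k -> (1 < 3 ^ k)%N.
Proof. by case: k => // k _; rewrite (ltn_exp2l 0). Qed.

Lemma uphalf_addn_half k : uphalf k + k./2 = k.
Proof. lia. Qed.

Lemma card_nearly_homocyclic3 mu : 2 <= mu ->
  #|{: nearly_homocyclic3 mu}| = (3 ^ mu)%N.
Proof.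
move=> le2mu; rewrite card_prod !card_ord !Zp_cast ?exp3_gt1 //; [|lia|lia].
by rewrite -expnD uphalf_addn_half.
Qed.

Lemma independent_cubesC (gT : finGroupType) (G : {group gT})
    (abG' : abelian G^`(1)) (x y : gT) :
  independent_cubes abG' x y -> independent_cubes abG' y x.
Proof.
by move=> ind u /ind[a [b Lab]]; exists b, a; rewrite [X in (_ - X)%R]addrC.
Qed.

Theorem theorem6p3 (gT : finGroupType) (G : {group gT})
    (abG' : abelian G^`(1)) (n m r e s : nat) :
  3.-group G ->
  abelian_type (G / G^`(1)) = [:: 3; 3] ->
  #|G| = (3 ^ n)%N -> (7 <= n)%N ->
  m = nilpotency_index G -> (5 <= m < n - 1)%N ->
  r = (n - nil_class G)%N -> (3 <= r)%N ->
  is_CF_invariant G e -> (4 <= e)%N ->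
  is_first_two_step G s ->
  is_defect G e s 0 ->
  [/\ forall x y : gT, normalized_generators G s x y ->
        isomorphic_add (fmod_of abG') {ideal_quot annihilator abG' x y} /\
        isomorphic_add {ideal_quot annihilator abG' x y}
          (nearly_homocyclic3 (m - 2) * nearly_homocyclic3 (e - 2))%type,
      isomorphic_add (fmod_of abG')
        (nearly_homocyclic3 (m - 2) * nearly_homocyclic3 (e - 2))%type,
      #|{: nearly_homocyclic3 (m - 2)}| = (3 ^ (m - 2))%N /\
      #|{: nearly_homocyclic3 (e - 2)}| = (3 ^ (e - 2))%N,
      ~~ 3.-abelem G^`(1)
    & 'r_3(G^`(1)) = 4].
Proof.
move=> pG typeG _ _ Dm /andP[le5m _] _ _ [_ min_e] le4e [[_ sG'] _] [_ defect].
have [cubeG [x0 [y0 defG0]]] := abelian_type33 pG typeG.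
have nilG := pgroup_nil pG.
have Lm : 'L_m(G) = 1 by rewrite Dm; apply/(lcn_nil_classP _ nilG).
(* The trivial term of index m has index at most 3 over the next one. *)
have lt_em : e < m.
  apply: min_e; split; first by lia.
  have := dvdn_indexg 'L_m(G) 'L_m.+1(G); rewrite /= Lm cards1 dvdn1.
  by move/eqP->.
have big_index j : 3 <= j <= e -> 3 < #|'L_j(G) : 'L_j.+1(G)|.
  move=> /andP[le3j lej]; rewrite ltnNge; apply/negP=> idxj.
  by have := min_e j (conj le3j idxj); lia.
have index3 : 3 < #|'L_3(G) : 'L_4(G)| by apply: big_index; lia.
have index4 : 3 < #|'L_4(G) : 'L_5(G)| by apply: big_index; lia.
have [_ [g chi_g G'g]] := properP sG'.
have Gg : g \in G by move: chi_g; rewrite inE => /andP[].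
have cent_g z : z \in 'L_e(G) -> [~ z, g] = 1.
  move=> Lz; have : [~ g, z] \in 'L_m(G).
    by rewrite Dm -[nilpotency_index G]subn0 -defect mem_commg.
  by rewrite Lm -invg_comm => /set1P/eqP; rewrite invg_eq1 => /eqP.
have [x [y [defG ind]]] := ex_independent_generators abG' cubeG index3 index4 defG0.
(* Exchanging x and y if necessary, the cube of x is killed by (y - 1)^(e - 2). *)
have basis : nearly_homocyclic_basis abG' m e.
  have le4m : 4 <= m by lia.
  have le3e : 3 <= e by lia.
  case: (defect_kills abG' cubeG index3 defG le3e Gg G'g cent_g) => kill.
    apply: (ex_nearly_homocyclic_basis cubeG index3 (generatorsC defG)) kill => //.
    exact: independent_cubesC.
  exact: (ex_nearly_homocyclic_basis cubeG index3 defG).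
have G'1 : G^`(1) != 1.
  apply/eqP=> G'1; have := generators_noncommuting index3 defG.
  have [Gx Gy] := pair_mem defG.
  have : [~ y, x] \in G^`(1) by rewrite mem_commg.
  by rewrite G'1 => /set1P->; rewrite eqxx.
have leG' : (3 ^ (m - 2 + (e - 2)) <= #|G^`(1)|)%N.
  by apply: card_der1_lower_bound => //; lia.
have [le2m le2e] : 2 <= m - 2 /\ 2 <= e - 2 by clear -le5m le4e; lia.
have half_gt0 mu : 2 <= mu -> 0 < uphalf mu /\ 0 < mu./2 by clear; lia.
have [[pos1 pos2] [pos3 pos4]] := (half_gt0 _ le2m, half_gt0 _ le2e).
have iso : isomorphic_add (fmod_of abG')
    (nearly_homocyclic3 (m - 2) * nearly_homocyclic3 (e - 2))%type.
  have [a1 [a2 [a3 [a4 [k1 k2 k3 k4 gen]]]]] := basis.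
  apply: (Zp_prod_isomorphic_add _ _ _ _ k1 k2 k3 k4 gen); try exact: exp3_gt1.
  by rewrite -!expnD card_fmod !uphalf_addn_half.
have rankG' : 'r_3(G^`(1)) = 4.
  have [f bij_f] := iso; have abOhm : abelian 'Ohm_1(G^`(1)).
    exact: abelianS (Ohm_sub _ _) abG'.
  have pG' : 3.-group G^`(1) := pgroupS (der_sub _ _) pG.
  rewrite p_rank_abelian // (OhmEabelian pG') // expn1 card_fmod_torsion.
  have pred_uphalf k : 0 < k -> (3 ^ k = 3 ^ k.-1.+1)%N by move/prednK->.
  rewrite -(card_image (bij_inj bij_f)).
  rewrite -[RHS](@pfactorK 3 4) // -(card_Zp_prod_torsion (pred_uphalf _ pos1)
    (pred_uphalf _ pos2) (pred_uphalf _ pos3) (pred_uphalf _ pos4)).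
  congr logn; apply: eq_card => p; rewrite [RHS]inE.
  have [h fK hK] := bij_f; apply/imageP/idP=> [[u uk ->]|pk].
    by rewrite -raddfMn (eqP uk) raddf0.
  exists (h p); last by rewrite hK.
  by rewrite inE -(can_eq fK) raddfMn raddf0 hK.
split=> //.
- move=> x1 y1 [defG1 _ _ _]; have isoQ := der1_isomorphic_quotient abG' defG1.
  by split=> //; apply: isomorphic_add_trans (isomorphic_add_sym isoQ) iso.
- by split; apply: card_nearly_homocyclic3.
apply/negP=> /p_rank_abelem; rewrite rankG'.
have -> : #|G^`(1)| = (3 ^ (m - 2 + (e - 2)))%N.
  have [f /bij_eq_card] := iso; rewrite card_fmod => ->.
  by rewrite card_prod !card_nearly_homocyclic3 ?expnD.
by rewrite pfactorK //; clear -le5m le4e; lia.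
Qed.
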